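(* Let $\Phi$ be the root system of an $F$-split reductive Lie algebra $\mathfrak{g}$ over a field $F$ of characteristic zero with respect to an $F$-split Cartan subalgebra $\mathfrak{h}$, let $(X_\alpha)_{\alpha\in\Phi}$ be a Chevalley system for $(\mathfrak{g},\mathfrak{h})$, let $\Phi^+$ be the set of positive roots with respect to a basis of $\Phi$, and put $\mathfrak{n}_{\mathbb{Z}}:=\sum_{\alpha\in\Phi^+}\mathbb{Z}X_\alpha$. Let $R$ be a commutative ring and $\mathfrak{n}_R:=R\otimes_{\mathbb{Z}}\mathfrak{n}_{\mathbb{Z}}$. If $2$ and $3$ are invertible in $R$, then $$\ker\Big(\bigwedge^2\mathfrak{n}_R\xrightarrow{\ [\;,\;]\ }\mathfrak{n}_R\Big)=\bigwedge\mathfrak{n}_R,$$ where $\bigwedge\mathfrak{n}_R\subseteq\bigwedge^2\mathfrak{n}_R$ is the $R$-submodule generated by all $x\wedge y$ with $x,y\in\mathfrak{n}_R$ and $[x,y]=0$.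
   Context: For $\alpha\in\Phi$ the root space $\mathfrak{g}^\alpha$ is one dimensional and $[\mathfrak{g}^\alpha,\mathfrak{g}^{-\alpha}]$ contains a unique element $H_\alpha$ with $\alpha(H_\alpha)=2$. A Chevalley system for $(\mathfrak{g},\mathfrak{h})$ (Bourbaki, Lie Groups and Lie Algebras, Chap. VIII) is a family of nonzero vectors $X_\alpha\in\mathfrak{g}^\alpha$ ($\alpha\in\Phi$) with $[X_\alpha,X_{-\alpha}]=-H_\alpha$ such that the linear map of $\mathfrak{g}$ equal to $-1$ on $\mathfrak{h}$ and sending $X_\alpha$ to $X_{-\alpha}$ for all $\alpha$ is a Lie algebra automorphism. For $\alpha,\beta,\alpha+\beta\in\Phi$ one then has $[X_\alpha,X_\beta]=N_{\alpha\beta}X_{\alpha+\beta}$ with $N_{\alpha\beta}$ an integer, so $\mathfrak{n}_{\mathbb{Z}}$ is a $\mathbb{Z}$-Lie subalgebra of $\mathfrak{g}$. Exterior squares are over $R$. *)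

(* Defs.v *)
From HB Require Import structures.
From mathcomp Require Import all_boot all_algebra.
From mathcomp Require Import finmap boolp classical_sets functions cardinality fsbigop.
Set Implicit Arguments.
Unset Strict Implicit.
Unset Printing Implicit Defensive.
Import GRing.Theory.
Local Open Scope ring_scope.
Local Open Scope classical_set_scope.
Local Open Scope quotient_scope.

Section SubmodGen.
Variables (R : pzRingType) (M : lmodType R).

Definition submod_gen (S : set M) : set M :=
  [set z | exists n (a : 'I_n -> R) (s : 'I_n -> M),
     (forall i, S (s i)) /\ z = \sum_i a i *: s i].

Variable S : set M.

Definition submod_gen_pred : {pred M} := fun z => `[< submod_gen S z >].

Lemma submod_gen_closed : subsemimod_closed submod_gen_pred.
Proof.
split=> [|a z].
  split=> [|z w].
    apply/asboolP; exists 0%N, (fun=> 0), (fun=> 0).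
    by split=> [[]//|]; rewrite big_ord0.
  move=> /asboolP[n [a [s [Ss ->]]]] /asboolP[m [b [t [St ->]]]].
  apply/asboolP; exists (n + m)%N.
  exists (fun i => match fintype.split i with inl j => a j | inr j => b j end).
  exists (fun i => match fintype.split i with inl j => s j | inr j => t j end).
  split=> [i|]; first by case: fintype.split.
  rewrite big_split_ord /=.
  congr (_ + _); apply: eq_bigr => i _.
    by rewrite -[lshift m i]/(unsplit (inl _)) unsplitK.
  by rewrite -[rshift n i]/(unsplit (inr _)) unsplitK.
move=> /asboolP[n [b [s [Ss ->]]]]; apply/asboolP.
exists n, (fun i => a * b i), s; split=> //.
by rewrite scaler_sumr; apply: eq_bigr => i _; rewrite scalerA.
Qed.

HB.instance Definition _ :=
  GRing.isSubmodClosed.Build R M submod_gen_pred submod_gen_closed.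

Lemma submod_genP z : reflect (submod_gen S z) (z \in submod_gen_pred).
Proof. exact: asboolP. Qed.

Lemma sub_submod_gen z : S z -> submod_gen S z.
Proof.
move=> Sz; exists 1%N, (fun=> 1), (fun=> z); split=> //.
by rewrite big_ord1 scale1r.
Qed.

Definition quot_mod : Type := Quotient.quot submod_gen_pred.
HB.instance Definition _ := GRing.Zmodule.on quot_mod.

Definition quot_pi (z : M) : quot_mod :=
  \pi_(Quotient.quot submod_gen_pred) z.

Lemma quot_piB : zmod_morphism quot_pi.
Proof. by move=> x y; rewrite /quot_pi !piE. Qed.

Lemma quot_pi_eq x y : (quot_pi x = quot_pi y) <-> submod_gen S (x - y).
Proof.
split=> [/eqP|h].
  by rewrite /quot_pi -Quotient.idealrBE => /submod_genP.
by apply/eqP; rewrite /quot_pi -Quotient.idealrBE; apply/submod_genP.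
Qed.

Definition quot_repr (u : quot_mod) : M :=
  repr (u : Quotient.quot submod_gen_pred).

Lemma quot_reprK u : quot_pi (quot_repr u) = u.
Proof. by rewrite /quot_pi /quot_repr reprK. Qed.

Definition quot_scale (a : R) (u : quot_mod) : quot_mod :=
  quot_pi (a *: quot_repr u).

Lemma quot_scale_pi a z : quot_scale a (quot_pi z) = quot_pi (a *: z).
Proof.
apply/quot_pi_eq; rewrite -scalerBr; apply/submod_genP/rpredZ/submod_genP.
by apply/quot_pi_eq; rewrite quot_reprK.
Qed.

Let piD x y : quot_pi (x + y) = quot_pi x + quot_pi y.
Proof. by rewrite /quot_pi !piE. Qed.

Lemma quot_scaleA a b u : quot_scale a (quot_scale b u) = quot_scale (a * b) u.
Proof. by rewrite -[u]quot_reprK !quot_scale_pi scalerA. Qed.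

Lemma quot_scale1 : left_id 1 quot_scale.
Proof. by move=> u; rewrite -[u]quot_reprK quot_scale_pi scale1r. Qed.

Lemma quot_scaleDr : right_distributive quot_scale +%R.
Proof.
move=> a u v; rewrite -[u]quot_reprK -[v]quot_reprK -piD !quot_scale_pi -piD.
by rewrite scalerDr.
Qed.

Lemma quot_scaleDl u : {morph quot_scale^~ u : a b / a + b}.
Proof.
by move=> a b; rewrite -[u]quot_reprK !quot_scale_pi -piD scalerDl.
Qed.

HB.instance Definition _ := GRing.Zmodule_isLmodule.Build R quot_mod
  quot_scaleA quot_scale1 quot_scaleDr quot_scaleDl.

Lemma quot_pi_linear : linear quot_pi.
Proof. by move=> a x y; rewrite piD -quot_scale_pi. Qed.

HB.instance Definition _ := GRing.isLinear.Build R M quot_mod *:%R quot_pi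
  quot_pi_linear.

Section Lift.
Variables (N : lmodType R) (f : {linear M -> N}).
Hypothesis f0 : forall z, S z -> f z = 0.

Definition quot_lift (u : quot_mod) : N := f (quot_repr u).

Lemma quot_lift_pi z : quot_lift (quot_pi z) = f z.
Proof.
have /quot_pi_eq[n [a [s [Ss E]]]] : quot_pi (quot_repr (quot_pi z)) = quot_pi z.
  by rewrite quot_reprK.
apply/eqP; rewrite /quot_lift -subr_eq0 -linearB E linear_sum big1 // => i _.
by rewrite linearZ /= f0 // scaler0.
Qed.

Lemma quot_lift_linear : linear quot_lift.
Proof.
move=> a u v; rewrite -[u]quot_reprK -[v]quot_reprK -linearP !quot_lift_pi.
exact: linearP.
Qed.

HB.instance Definition _ := GRing.isLinear.Build R quot_mod N *:%R quot_lift
  quot_lift_linear.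
End Lift.
End SubmodGen.

Section FreeModule.
Variables (R : pzRingType) (K : choiceType).

Definition fin_supp : {pred K -> R^o} :=
  fun f => `[< finite_set [set k | f k != 0] >].

Lemma fin_supp_closed : subsemimod_closed fin_supp.
Proof.
split=> [|a f /asboolP ff].
  split=> [|f g /asboolP ff /asboolP fg]; apply/asboolP.
    by apply: (sub_finite_set _ (finite_set0 K)) => k /=; rewrite eqxx.
  apply: (sub_finite_set (B := [set k | f k != 0] `|` [set k | g k != 0])).
    move=> k /=; rewrite -[(f + g) k]/(f k + g k).
    have [->|] := eqVneq (f k) 0; last by left.
    by rewrite add0r; right.
  by rewrite finite_setU.
apply/asboolP; apply: sub_finite_set ff => k /=.
rewrite -[(a *: f) k]/(a * f k).
by apply: contra_neq => ->; rewrite mulr0.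
Qed.

HB.instance Definition _ :=
  GRing.isSubmodClosed.Build R (K -> R^o) fin_supp fin_supp_closed.

Record free_module : Type := FreeModule {
  free_val :> K -> R^o; _ : free_val \in fin_supp }.
HB.instance Definition _ := [isSub for free_val].
HB.instance Definition _ := [Choice of free_module by <:].
HB.instance Definition _ := [SubChoice_isSubLmodule of free_module by <:].

Lemma free_gen_subproof (k : K) : (fun j => (j == k)%:R : R^o) \in fin_supp.
Proof.
apply/asboolP; apply: (sub_finite_set _ (finite_set1 k)) => j /=.
by case: (j =P k) => [//|_]; rewrite eqxx.
Qed.

Definition free_gen (k : K) : free_module := FreeModule (free_gen_subproof k).

Lemma free_finite (f : free_module) : finite_set [set k | f k != 0].
Proof. exact/asboolP/(valP f). Qed.

Lemma free_sumE (f : free_module) (A : {fset K}) :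
    (forall k, k \notin A -> f k = 0) ->
  f = \sum_(k <- A) (f k : R) *: free_gen k.
Proof.
move=> fA; apply/val_inj/funext => j; rewrite raddf_sum /= fct_sumE /=.
rewrite (eq_bigr (fun k => f k * (j == k)%:R)) //.
have [jA|jA] := boolP (j \in A); last first.
  rewrite fA // big_seq big1 // => k kA; case: eqP => [jk|]; last by rewrite mulr0.
  by move: jA; rewrite jk kA.
rewrite (big_fsetD1 j) //= eqxx mulr1 big_seq big1 ?addr0 // => k.
by rewrite !inE eq_sym => /andP[/negPf -> _]; rewrite mulr0.
Qed.

Variables (N : lmodType R) (v : K -> N).

Definition free_lift (f : free_module) : N :=
  \sum_(k \in [set: K]) (f k : R) *: v k.

Lemma free_liftE (f : free_module) (A : {fset K}) :
    (forall k, k \notin A -> f k = 0) ->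
  free_lift f = \sum_(k <- A) (f k : R) *: v k.
Proof. by move=> fA; apply: fsbigTE => k /fA ->; rewrite scale0r. Qed.

Lemma free_lift_linear : linear free_lift.
Proof.
move=> a f g.
pose A := (fset_set [set k | f k != 0] `|` fset_set [set k | g k != 0])%fset.
have fA k : k \notin A -> f k = 0.
  rewrite !inE negb_or !in_fset_set; try exact: free_finite.
  by case/andP => + _; rewrite notin_setE /= => /negP; rewrite negbK => /eqP.
have gA k : k \notin A -> g k = 0.
  rewrite !inE negb_or !in_fset_set; try exact: free_finite.
  by case/andP => _; rewrite notin_setE /= => /negP; rewrite negbK => /eqP.
rewrite (free_liftE fA) (free_liftE gA) (@free_liftE _ A) => [|k kA]; last first.
  by rewrite -[LHS]/(a * f k + g k) fA // gA // mulr0 addr0.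
rewrite scaler_sumr -big_split /=; apply: eq_bigr => k _.
by rewrite scalerA -scalerDl.
Qed.

HB.instance Definition _ := GRing.isLinear.Build R free_module N *:%R free_lift
  free_lift_linear.

Lemma free_lift_gen k : free_lift (free_gen k) = v k.
Proof.
rewrite (@free_liftE _ [fset k]%fset) ?big_seq_fset1 /= ?eqxx ?scale1r // => j.
by rewrite inE => /negPf ->.
Qed.
End FreeModule.

Section Exterior.
(* comPzRingType: the zero ring is allowed. *)
Variable R : comPzRingType.

Record alt_map (M N : lmodType R) := AltMap {
  alt_fun :> M -> M -> N;
  alt_linearl : forall y, linear (alt_fun^~ y);
  alt_linearr : forall x, linear (alt_fun x);
  alt_xx : forall x, alt_fun x x = 0 }.

Section Ext2.
Variable M : lmodType R.

Let e (x y : M) : free_module R [the choiceType of (M * M)%type] := free_gen R (x, y).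

Definition ext2_rel : set (free_module R [the choiceType of (M * M)%type]) :=
  [set z | (exists a x x' y, z = e (a *: x + x') y - (a *: e x y + e x' y))
        \/ (exists a x y y', z = e x (a *: y + y') - (a *: e x y + e x y'))
        \/ (exists x, z = e x x)].

Definition ext2 : Type := quot_mod ext2_rel.
HB.instance Definition _ := GRing.Lmodule.on ext2.

Definition wedge (x y : M) : ext2 := quot_pi ext2_rel (e x y).

Lemma wedge_linearl y : linear (wedge^~ y).
Proof.
move=> a x x'; rewrite /wedge -linearP; apply/quot_pi_eq/sub_submod_gen.
by left; exists a, x, x', y.
Qed.

Lemma wedge_linearr x : linear (wedge x).
Proof.
move=> a y y'; rewrite /wedge -linearP; apply/quot_pi_eq/sub_submod_gen.
by right; left; exists a, x, y, y'.
Qed.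

Lemma wedge_xx x : wedge x x = 0.
Proof.
rewrite /wedge -(linear0 (quot_pi ext2_rel)).
by apply/quot_pi_eq/sub_submod_gen; right; right; exists x; rewrite subr0.
Qed.

Section Lift.
Variables (N : lmodType R) (f : alt_map M N).

Let f2 := free_lift (fun p : M * M => f p.1 p.2).

Lemma ext2_rel0 z : ext2_rel z -> f2 z = 0.
Proof.
case=> [[a [x [x' [y ->]]]]|[[a [x [y [y' ->]]]]|[x ->]]].
- by rewrite /f2 /e linearB linearP /= !free_lift_gen /= alt_linearl subrr.
- by rewrite /f2 /e linearB linearP /= !free_lift_gen /= alt_linearr subrr.
- by rewrite /f2 /e free_lift_gen /= alt_xx.
Qed.

Definition ext2_lift : ext2 -> N := quot_lift (S := ext2_rel) f2.

Lemma ext2_lift_linear : linear ext2_lift.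
Proof. exact: (quot_lift_linear ext2_rel0). Qed.

HB.instance Definition _ := GRing.isLinear.Build R ext2 N *:%R ext2_lift
  ext2_lift_linear.

Lemma ext2_lift_wedge x y : ext2_lift (wedge x y) = f x y.
Proof. exact: etrans (quot_lift_pi ext2_rel0 _) (free_lift_gen _ _). Qed.
End Lift.
End Ext2.
End Exterior.

(* The alternating biadditive maps, for abelian groups (Z-modules). *)
Record alt_biadd (L : zmodType) := AltBiadd {
  biadd_fun :> L -> L -> L;
  biaddl : forall y, zmod_morphism (biadd_fun^~ y);
  biaddr : forall x, zmod_morphism (biadd_fun x);
  biadd_xx : forall x, biadd_fun x x = 0 }.

Section TensorZ.
Variables (R : comPzRingType) (L : zmodType).

Let e (r : R) (x : L) : free_module R [the choiceType of (R * L)%type] := free_gen R (r, x).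

(* Compatibility with the action of Z follows from biadditivity. *)
Definition tensor_rel : set (free_module R [the choiceType of (R * L)%type]) :=
  [set z | (exists a r r' x, z = e (a * r + r') x - (a *: e r x + e r' x))
        \/ (exists r x x', z = e r (x + x') - (e r x + e r x'))].

Definition tensorZ : Type := quot_mod tensor_rel.
HB.instance Definition _ := GRing.Lmodule.on tensorZ.

Definition tens (r : R) (x : L) : tensorZ := quot_pi tensor_rel (e r x).

Lemma tens_linearl x : linear ((tens^~ x) : R^o -> tensorZ).
Proof.
move=> a r r'; rewrite /tens -linearP; apply/quot_pi_eq/sub_submod_gen.
by left; exists a, r, r', x.
Qed.

Lemma tensDr r x x' : tens r (x + x') = tens r x + tens r x'.
Proof.
rewrite /tens -linearD; apply/quot_pi_eq/sub_submod_gen.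
by right; exists r, x, x'.
Qed.

Lemma tens_r0 r : tens r 0 = 0.
Proof. by apply: (addrI (tens r 0)); rewrite -tensDr !addr0. Qed.

Lemma tensNr r x : tens r (- x) = - tens r x.
Proof. by apply/eqP; rewrite -addr_eq0 -tensDr addNr tens_r0. Qed.

Lemma tens_ind (P : tensorZ -> Prop) :
  (forall r x, P (tens r x)) -> (forall u w, P u -> P w -> P (u + w)) ->
  forall u, P u.
Proof.
move=> Pt PD u; rewrite -[u]quot_reprK; move: (quot_repr u) => f.
rewrite (@free_sumE _ _ f (fset_set [set k | f k != 0])) => [|k]; last first.
  rewrite in_fset_set; last exact: free_finite.
  by rewrite notin_setE /= => /negP; rewrite negbK => /eqP.
rewrite linear_sum; apply: big_ind => [||[r x] _].
- by rewrite -(tens_r0 0); apply: Pt.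
- exact: PD.
rewrite linearZ /= -[quot_pi _ _]/(tens r x).
have := tens_linearl x (f (r, x)) r 0; rewrite addr0.
have -> : tens 0 x = 0.
  have := tens_linearl x 1 0 0.
  by rewrite !scale1r addr0 -[LHS]addr0 => /addrI.
by rewrite addr0 => <-; apply: Pt.
Qed.

Section Lift.
Variables (N : lmodType R) (f : R -> L -> N).
Hypothesis fl : forall x, linear ((f^~ x) : R^o -> N).
Hypothesis fr : forall r x x', f r (x + x') = f r x + f r x'.

Let f2 := free_lift (fun p : R * L => f p.1 p.2).

Lemma tensor_rel0 z : tensor_rel z -> f2 z = 0.
Proof.
case=> [[a [r [r' [x ->]]]]|[r [x [x' ->]]]].
- by rewrite /f2 /e linearB linearP /= !free_lift_gen /= -[a * r]/(a *: (r : R^o)) fl subrr.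
- by rewrite /f2 /e linearB linearD /= !free_lift_gen /= fr subrr.
Qed.

Definition tensor_lift : tensorZ -> N := quot_lift (S := tensor_rel) f2.

Lemma tensor_lift_linear : linear tensor_lift.
Proof. exact: (quot_lift_linear tensor_rel0). Qed.

Lemma tensor_lift_tens r x : tensor_lift (tens r x) = f r x.
Proof. exact: etrans (quot_lift_pi tensor_rel0 _) (free_lift_gen _ _). Qed.
End Lift.

Section BaseChange.
Variable b : alt_biadd L.

Let bDl y x x' : b (x + x') y = b x y + b x' y.
Proof.
have b0 : b 0 y = 0 by have := biaddl b y 0 0; rewrite !subrr.
have := biaddl b y x (- x'); rewrite opprK => ->.
by have := biaddl b y 0 x'; rewrite sub0r b0 sub0r => ->; rewrite opprK.
Qed.

Let bDr x y y' : b x (y + y') = b x y + b x y'.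
Proof.
have b0 : b x 0 = 0 by have := biaddr b x 0 0; rewrite !subrr.
have := biaddr b x y (- y'); rewrite opprK => ->.
by have := biaddr b x 0 y'; rewrite sub0r b0 sub0r => ->; rewrite opprK.
Qed.

Let bC x y : b y x = - b x y.
Proof.
apply/eqP; rewrite -addr_eq0 addrC.
by have := biadd_xx b (x + y); rewrite bDl !bDr !biadd_xx add0r addr0 => ->.
Qed.

Let b1 (s : R) (y : L) : tensorZ -> tensorZ :=
  tensor_lift (fun r x => tens (r * s) (b x y)).

Let b1l s y x :
  linear ((fun r => tens (r * s) (b x y)) : R^o -> tensorZ).
Proof.
move=> a r r'; rewrite -tens_linearl; congr tens.
by rewrite mulrDl -[a *: r]/(a * r) -mulrA.
Qed.

Let b1r s y r x x' :
  tens (r * s) (b (x + x') y) = tens (r * s) (b x y) + tens (r * s) (b x' y).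
Proof. by rewrite bDl tensDr. Qed.

Let b1_linear s y : linear (b1 s y).
Proof. exact: tensor_lift_linear (@b1l s y) (@b1r s y). Qed.

Let b1E s y r x : b1 s y (tens r x) = tens (r * s) (b x y).
Proof. exact: (tensor_lift_tens (@b1l s y) (@b1r s y)). Qed.

Let b1D s y u w : b1 s y (u + w) = b1 s y u + b1 s y w.
Proof. by have := b1_linear s y 1 u w; rewrite !scale1r. Qed.

Let b2l y : linear ((b1^~ y) : R^o -> (tensorZ -> tensorZ)).
Proof.
move=> a s s'; apply/funext; elim/tens_ind => [r x|u w Hu Hw].
  rewrite -[RHS]/(a *: b1 s y (tens r x) + b1 s' y (tens r x)) !b1E.
  rewrite -tens_linearl; congr tens.
  by rewrite mulrDr -[a *: s]/(a * s) -[a *: (_ : R^o)]/(a * _) mulrCA.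
rewrite b1D Hu Hw -[RHS]/(a *: b1 s y (u + w) + b1 s' y (u + w)) !b1D scalerDr.
by rewrite addrACA.
Qed.

Let b2r s y y' : b1 s (y + y') = b1 s y + b1 s y'.
Proof.
apply/funext; elim/tens_ind => [r x|u w Hu Hw].
  rewrite -[RHS]/(b1 s y (tens r x) + b1 s y' (tens r x)) !b1E.
  by rewrite bDr tensDr.
rewrite b1D Hu Hw -[RHS]/(b1 s y (u + w) + b1 s y' (u + w)) !b1D.
by rewrite addrACA.
Qed.

Definition base_change_fun (u w : tensorZ) : tensorZ := tensor_lift b1 w u.

Lemma base_change_fun_tens r x s y :
  base_change_fun (tens r x) (tens s y) = tens (r * s) (b x y).
Proof. by rewrite /base_change_fun (tensor_lift_tens b2l b2r) b1E. Qed.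

Lemma base_change_linearr u : linear (base_change_fun u).
Proof.
by move=> a w w'; rewrite /base_change_fun (tensor_lift_linear b2l b2r).
Qed.

Let bcDr u w w' :
  base_change_fun u (w + w') = base_change_fun u w + base_change_fun u w'.
Proof. by have := base_change_linearr u 1 w w'; rewrite !scale1r. Qed.

Lemma base_change_linearl w : linear (base_change_fun^~ w).
Proof.
move=> a u u'; elim/tens_ind: w => [s y|w w' H H'].
  by rewrite /base_change_fun (tensor_lift_tens b2l b2r) b1_linear.
by rewrite !bcDr H H' scalerDr addrACA.
Qed.

Let bcDl u u' w :
  base_change_fun (u + u') w = base_change_fun u w + base_change_fun u' w.
Proof. by have := base_change_linearl w 1 u u'; rewrite !scale1r. Qed.

Let bcC u w : base_change_fun u w = - base_change_fun w u.
Proof.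
elim/tens_ind: u => [r x|u u' Hu Hu']; last by rewrite bcDl bcDr Hu Hu' opprD.
elim/tens_ind: w => [s y|w w' Hw Hw']; last by rewrite bcDl bcDr Hw Hw' opprD.
by rewrite !base_change_fun_tens bC tensNr mulrC.
Qed.

Lemma base_change_xx u : base_change_fun u u = 0.
Proof.
elim/tens_ind: u => [r x|u w Hu Hw].
  by rewrite base_change_fun_tens biadd_xx tens_r0.
by rewrite bcDl !bcDr Hu Hw (bcC w u) add0r addr0 subrr.
Qed.

Definition base_change : alt_map tensorZ tensorZ :=
  AltMap base_change_linearl base_change_linearr base_change_xx.

Lemma base_change_tens r x s y :
  base_change (tens r x) (tens s y) = tens (r * s) (b x y).
Proof. exact: base_change_fun_tens. Qed.
End BaseChange.
End TensorZ.

HB.mixin Record isLieAlgebra (F : fieldType) g of Vector F g := {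
  lie : g -> g -> g;
  lie_linearl : forall y, linear (lie^~ y);
  lie_linearr : forall x, linear (lie x);
  lie_xx : forall x, lie x x = 0;
  lie_jacobi : forall x y z, lie x (lie y z) + lie y (lie z x) + lie z (lie x y) = 0
}.

#[short(type="lieAlgType")]
HB.structure Definition LieAlgebra (F : fieldType) :=
  {g of isLieAlgebra F g & Vector F g}.

Section Reductive.
Variables (F : fieldType) (g : lieAlgType F).

Lemma lieBl y : zmod_morphism ((@lie F g)^~ y).
Proof.
move=> x x'; rewrite addrC -scaleN1r lie_linearl scaleN1r.
exact: addrC.
Qed.

Lemma lieBr x : zmod_morphism (@lie F g x).
Proof.
move=> y y'; rewrite addrC -scaleN1r lie_linearr scaleN1r.
exact: addrC.
Qed.

Definition lie_ideal (I : {vspace g}) : Prop :=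
  forall x y : g, y \in I -> lie x y \in I.

(* Bourbaki: the adjoint representation is semisimple; its submodules are the
   ideals of g. *)
Definition reductive : Prop :=
  forall I : {vspace g}, lie_ideal I ->
  exists J : {vspace g},
    [/\ lie_ideal J, (I + J)%VS = fullv & (I :&: J)%VS = 0%VS].

Definition lie_subalgebra (h : {vspace g}) : Prop :=
  forall x y : g, x \in h -> y \in h -> lie x y \in h.

Definition lie_vspace (U V : {vspace g}) : {vspace g} :=
  <<[seq lie x y | x <- vbasis U, y <- vbasis V]>>%VS.

Definition lie_nilpotent (h : {vspace g}) : Prop :=
  exists n, iter n (lie_vspace h) h = 0%VS.

Definition cartan_subalgebra (h : {vspace g}) : Prop :=
  [/\ lie_subalgebra h, lie_nilpotent h &
      forall x : g, (forall y, y \in h -> lie x y \in h) -> x \in h].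

(* Some basis of g makes the matrix of f triangular. *)
Definition triangularizable (f : g -> g) : Prop :=
  exists e : seq g, basis_of fullv e /\
    forall i, (i < size e)%N -> f e`_i \in <<take i.+1 e>>%VS.

(* Splitting Cartan subalgebra in the sense of Bourbaki, Chap. VIII. *)
Definition split_cartan (h : {vspace g}) : Prop :=
  cartan_subalgebra h /\ forall x : g, x \in h -> triangularizable (lie x).
End Reductive.

Section Roots.
Variables (F : fieldType) (g : lieAlgType F) (h : {vspace g}).

Definition hdual := 'Hom(subvs_of h, F^o).
HB.instance Definition _ := Vector.on hdual.

Definition root_space (alpha : hdual) : set g :=
  [set y | forall t : subvs_of h, lie (vsval t) y = (alpha t : F) *: y].

Definition is_root (alpha : hdual) : Prop :=
  alpha != 0 /\ exists y, y != 0 /\ root_space alpha y.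

(* t is H_alpha; [g^alpha, g^(-alpha)] is the linear span of the brackets. *)
Definition is_coroot (alpha : hdual) (t : subvs_of h) : Prop :=
  submod_gen [set z | exists x y,
    [/\ root_space alpha x, root_space (- alpha) y & z = lie x y]] (vsval t)
  /\ (alpha t : F) = 2.

(* Only the values of X at roots matter. The map theta is determined by its
   values on h and on the X alpha, since these span g. *)
Definition chevalley_system (X : hdual -> g) : Prop :=
  (forall alpha, is_root alpha ->
     [/\ X alpha != 0, root_space alpha (X alpha)
       & exists2 t, is_coroot alpha t &
           lie (X alpha) (X (- alpha)) = - vsval t])
  /\ exists theta : 'End(g),
       [/\ lker theta = 0%VS,
           forall x y, theta (lie x y) = lie (theta x) (theta y),
           forall x, x \in h -> theta x = - x
         & forall alpha, is_root alpha -> theta (X alpha) = X (- alpha)].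

Definition nat_comb (B : seq hdual) (alpha : hdual) : Prop :=
  exists c : 'I_(size B) -> nat, alpha = \sum_(i < size B) B`_i *+ c i.

Definition root_basis (B : seq hdual) : Prop :=
  [/\ free B, forall b, b \in B -> is_root b
    & forall alpha, is_root alpha -> nat_comb B alpha \/ nat_comb B (- alpha)].

Definition positive_root (B : seq hdual) (alpha : hdual) : Prop :=
  is_root alpha /\ nat_comb B alpha.

Section NZ.
Variables (B : seq hdual) (X : hdual -> g).

(* The subgroup generated by the X alpha with alpha a positive root. *)
Definition nZ_pred : {pred g} := fun x =>
  `[< exists s : seq (int * hdual),
        (forall p, p \in s -> positive_root B p.2)
        /\ x = \sum_(p <- s) X p.2 *~ p.1 >].

Lemma nZ_zmod_closed : zmod_closed nZ_pred.
Proof.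
split=> [|x y /asboolP[s [Ps ->]] /asboolP[t [Pt ->]]]; apply/asboolP.
  by exists [::]; split=> //; rewrite big_nil.
exists (s ++ [seq (- p.1, p.2) | p <- t]); split=> [p|].
  by rewrite mem_cat => /orP[/Ps//|/mapP[q /Pt Pq ->]].
rewrite big_cat big_map /=; congr (_ + _).
by rewrite -sumrN; apply: eq_bigr => p _; rewrite mulrNz.
Qed.

HB.instance Definition _ := GRing.isZmodClosed.Build g nZ_pred nZ_zmod_closed.

Record nZ : Type := NZ { nZ_val :> g; _ : nZ_val \in nZ_pred }.
HB.instance Definition _ := [isSub for nZ_val].
HB.instance Definition _ := [Choice of nZ by <:].
HB.instance Definition _ := [SubChoice_isSubZmodule of nZ by <:].

Lemma nZ_valB : zmod_morphism nZ_val.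
Proof. exact: (raddfB \val). Qed.

HB.instance Definition _ := GRing.isZmodMorphism.Build nZ g nZ_val nZ_valB.

Definition nZ_lie_closed : Prop :=
  forall x y : nZ, lie (nZ_val x) (nZ_val y) \in nZ_pred.

Section Bracket.
Hypothesis cl : nZ_lie_closed.

Definition nZ_lie_fun (x y : nZ) : nZ := NZ (cl x y).

Lemma nZ_liel y : zmod_morphism (nZ_lie_fun^~ y).
Proof.
move=> x x'; apply: (val_inj : injective nZ_val); rewrite nZ_valB.
by rewrite -lieBl /= -nZ_valB.
Qed.

Lemma nZ_lier x : zmod_morphism (nZ_lie_fun x).
Proof.
move=> y y'; apply: (val_inj : injective nZ_val); rewrite nZ_valB.
by rewrite -lieBr /= -nZ_valB.
Qed.

Lemma nZ_lie_xx x : nZ_lie_fun x x = 0.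
Proof. by apply: (val_inj : injective nZ_val); rewrite -(subrr 0) nZ_valB subrr; exact: lie_xx. Qed.

Definition nZ_lie : alt_biadd nZ := AltBiadd nZ_liel nZ_lier nZ_lie_xx.
End Bracket.
End NZ.
End Roots.

(* Main.v *)
Require Import Defs.
From HB Require Import structures.
From mathcomp Require Import all_boot all_order all_algebra.
From mathcomp Require Import finmap boolp classical_sets functions cardinality.
From mathcomp Require Import ring lra zify.
Set Implicit Arguments.
Unset Strict Implicit.
Unset Printing Implicit Defensive.
Import Order.TTheory GRing.Theory Num.Theory.
Local Open Scope ring_scope.
Local Open Scope classical_set_scope.

(** The bracket is graded by the root lattice, so its kernel on the exterior
square splits by weight.  In a weight c that is not a root every
X_a /\ X_b with a + b = c is a wedge of commuting vectors.  In a weight c that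
is a root the kernel is generated by the combinations
N' (X_a /\ X_b) - N (X_a' /\ X_b') over pairs of decompositions
c = a + b = a' + b', where N and N' are the structure constants; this uses that
N' is invertible in R.  Two facts make these combinations sums of commuting
wedges.

- Structure constants are 1, 2 or 3 up to sign (structure_constant), because
  N ^ 2 = (p + 1) ^ 2 for the a-string through b, which has at most four terms.

- Given two decompositions, either a + b' and a' + b are not roots, or a + a'
  and b + b' are not roots (two_decompositions).  In the first case
  X_a + X_a' commutes with N' X_b - N X_b', and the wedge of these two vectors is
  the combination above up to the commuting wedges X_a /\ X_b' and X_a' /\ X_b;
  in the second case the same holds after exchanging a' and b'.

If the second fact failed, there would be roots u, v, w such that v + w, u + v,
u + w and v + w - u are roots too.  Any two roots whose sum is a root span a
system of type A2, B2 or G2, which leaves finitely many length ratios and angles,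
and no choice of these is consistent (no_crossed_sums).

To conclude without discussing bases of the exterior square, choose for each root
c an element o_c with X_a /\ X_b = N o_c modulo commuting wedges for all
decompositions of c (wedge_normal_form), and let f be the linear map from n_R to
the exterior square sending X_c to o_c.  Then z - f [z] is a sum of commuting
wedges for every z (bracket_kernel), and so is z itself when its bracket [z]
vanishes.  The map f exists because the X_c with c positive form a basis of n_Z.

The facts on roots are derived from the sl2-triples of the Chevalley system.
If y has weight b and [X_a, [X_-a, y]] is a multiple of y, the multiple is
computed by raising y until it vanishes (sl2_eigenvalue).  This gives
one-dimensionality of the root spaces, integrality of the numbers b(H_a), and
root strings; the form sum_c c(H_a) c(H_b), invariant under reflections,
then bounds b(H_a) a(H_b) by 3. *)

(** * Abstract Cartan numbers *)

(** Entries are 6 (y,y) / (x,x) and 12 (x,y) / (x,x) for roots x, y whose sum is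
a root; the factor 6 clears the denominators 2 and 3 of the length ratios. *)
Definition sixfold_lengths : seq (int * int) :=
  [:: (6, -6); (6, 0); (6, 6); (12, -12); (3, -6); (18, -18); (2, -6)].

(** The part of the axioms of a reduced root system that concerns sums of two
roots.  There is no ambient Euclidean space: [cnum x y] is 2 (x,y) / (y,y), and
[sqlen y] is (y,y), so that the product of the two is the bilinear form 2 (x,y). *)
Record cartan_data (V : zmodType) (root : V -> Prop) := CartanData {
  cnum : V -> V -> int;
  sqlen : V -> rat;
  cdN : forall x, root x -> root (- x);
  cd_reduced : forall x, root x -> ~ root (x + x);
  cnumDl : forall x y z, root x -> root y -> root (x + y) -> root z ->
    cnum (x + y) z = cnum x z + cnum y z;
  cnum_diag : forall x, root x -> cnum x x = 2;
  sqlen_gt0 : forall x, root x -> 0 < sqlen x;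
  cnum_sqlen : forall x y, root x -> root y ->
    (cnum x y)%:~R * sqlen y = (cnum y x)%:~R * sqlen x;
  cnum_bound : forall x y, root x -> root y -> x <> y -> x <> - y ->
    0 <= cnum x y * cnum y x <= 3 }.

Section CartanData.
Variables (V : zmodType) (root : V -> Prop) (C : cartan_data root).
Local Notation c := (cnum C).
Local Notation n := (sqlen C).
Local Notation ip x y := ((c x y)%:~R * n y).

Lemma ipDl x y z : root x -> root y -> root (x + y) -> root z ->
  ip (x + y) z = ip x z + ip y z.
Proof. by move=> *; rewrite cnumDl // rmorphD mulrDl. Qed.

Lemma ipDr x y z : root x -> root y -> root (x + y) -> root z ->
  ip z (x + y) = ip z x + ip z y.
Proof.
move=> rx ry rxy rz.
by rewrite cnum_sqlen // ipDl // (cnum_sqlen C rx) // (cnum_sqlen C ry).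
Qed.

Lemma ip_diag x : root x -> ip x x = 2 * n x.
Proof. by move=> rx; rewrite cnum_diag. Qed.

Lemma sqlenD x y : root x -> root y -> root (x + y) ->
  n (x + y) = n x + n y + ip x y.
Proof.
move=> rx ry rxy; have := ip_diag rxy.
rewrite ipDl // !ipDr // !ip_diag // (cnum_sqlen C ry) //.
lra.
Qed.

Lemma root_sum_neq x y : root x -> root y -> root (x + y) -> x <> y /\ x <> - y.
Proof.
move=> rx ry rxy; split=> e; first by apply: (cd_reduced C ry); rewrite -{1}e.
have r0 : root 0 by rewrite e addNr in rxy.
have := cnumDl C r0 r0; rewrite addr0 => /(_ _ r0 r0).
by rewrite (cnum_diag C r0).
Qed.

Lemma cnum_cases x y : root x -> root y -> x <> y -> x <> - y ->
  [\/ c x y = 0 /\ c y x = 0,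
      c x y = 1 /\ (0 < c y x <= 3), c y x = 1 /\ (0 < c x y <= 3)
    | (c x y = -1 /\ (-3 <= c y x < 0)) \/ (c y x = -1 /\ (-3 <= c x y < 0))].
Proof.
move=> rx ry xy xNy; have := cnum_bound C rx ry xy xNy.
have := cnum_sqlen C rx ry; have := sqlen_gt0 C rx; have := sqlen_gt0 C ry.
move: (c x y) (c y x) (n x) (n y) => a b p q q0 p0 e /andP[ab0 ab3].
have [a0|a0] := eqVneq a 0.
  constructor 1; split=> //; move/eqP: e.
  by rewrite a0 mul0r eq_sym mulf_eq0 intr_eq0 (gt_eqF p0) orbF => /eqP.
have b0 : b != 0.
  by apply: contra_eq_neq e => ->; rewrite mul0r mulf_eq0 intr_eq0 negb_or a0 gt_eqF.
have ab : 0 < a * b by lia.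
have [ap|an] := ltP 0 a.
  have bp : 0 < b by nia.
  have [a1|a1] := eqVneq a 1; first by constructor 2; nia.
  by constructor 3; nia.
constructor 4; have bn : b < 0 by nia.
by have [a1|a1] := eqVneq a (-1); [left|right]; nia.
Qed.

(** In rank two the numbers determine the triple: x, y, x + y span a system of
type A2, B2 or G2, and the seven entries are the positions of the triple in it.
Only finitely many pairs of Cartan numbers of x and y satisfy the product bound;
the others are excluded by the integrality and the product bound of the numbers
taken against x + y. *)
Lemma cnum_sum x y : root x -> root y -> root (x + y) ->
  (c x y, c y x, c x (x + y), c y (x + y)) \in
    [:: (-1, -1, 1, 1); (0, 0, 1, 1); (1, 1, 1, 1);
        (-1, -2, 0, 2); (-2, -1, 2, 0); (-1, -3, -1, 3); (-3, -1, 3, -1)].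
Proof.
move=> rx ry rz; have [xy xNy] := root_sum_neq rx ry rz.
have neq0 u : root u -> u <> 0.
  by move=> ru u0; apply: (cd_reduced C ru); rewrite {1}u0 add0r.
have bound u v : root u -> root v -> root (u + v) ->
    0 <= c u (u + v) * (2 + c v u) <= 3.
  move=> ru rv rw; rewrite -(cnum_diag C ru) -cnumDl //; apply: cnum_bound => //.
    by rewrite -{1}[u]addr0 => /addrI /esym; apply: neq0.
  move=> e; apply: (cd_reduced C ru); rewrite {1}e opprD -addrA (addrC _ u).
  by rewrite addrA addNr add0r; apply: cdN.
have bx := bound _ _ rx ry rz.
have := bound _ _ ry rx; rewrite addrC => /(_ rz) by_.
have ez := sqlenD rx ry rz.
have exz := cnum_sqlen C rx rz; have eyz := cnum_sqlen C ry rz.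
have exy := cnum_sqlen C rx ry.
rewrite !cnumDl // !cnum_diag // in exz eyz.
have p0 := sqlen_gt0 C rx; have q0 := sqlen_gt0 C ry.
have := cnum_cases rx ry xy xNy.
rewrite !inE !xpair_eqE.
have r0 := sqlen_gt0 C rz.
move: (c x y) (c y x) (c x (x + y)) (c y (x + y)) (n x) (n y) (n (x + y))
  r0 p0 q0 exy exz eyz ez bx by_ => a b d e p q r r0 p0 q0 exy exz eyz ez bx by_ H.
have {}H : (a, b) \in [:: (0,0); (1,1); (1,2); (1,3); (2,1); (3,1);
   (-1,-1); (-1,-2); (-1,-3); (-2,-1); (-3,-1)].
  rewrite !inE !xpair_eqE; case: H => [H|H|H|[H|H]]; lia.
rewrite [a + 2]addrC in eyz.
(* A number whose product bound is vacuous, the other factor 2 + v being zero,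
   vanishes by symmetry. *)
have small u v w : 0 <= u * (2 + v) <= 3 -> u%:~R * r = (2 + v)%:~R * w ->
    (-3 <= v <= 3) -> u \in [:: -3; -2; -1; 0; 1; 2; 3].
  have [-> _|v2 uv _ _] := eqVneq v (-2); last by rewrite !inE; nia.
  rewrite addrN mul0r => /eqP.
  by rewrite mulf_eq0 intr_eq0 (gt_eqF r0) orbF => /eqP-> _.
have b3 : -3 <= b <= 3 /\ -3 <= a <= 3.
  by move: H; rewrite !inE !xpair_eqE; lia.
have := small _ _ _ bx exz b3.1; have := small _ _ _ by_ eyz b3.2.
move: H; rewrite !inE => {small}.
do ?[case/orP]; case/eqP => ? ?; subst a b; clear - r0 p0 q0 exy exz eyz ez bx by_.
all: do ?[case/orP]; move=> /eqP ?; subst e; try by exfalso; lra.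
all: do ?[case/orP]; move=> /eqP ?; subst d; try by exfalso; lra.
all: by [].
Qed.

Lemma sqlen_ip_sum x y : root x -> root y -> root (x + y) ->
  exists2 p, p \in sixfold_lengths &
    6 * n y = p.1%:~R * n x /\ 6 * ip x y = p.2%:~R * n x.
Proof.
move=> rx ry rz; have := cnum_sum rx ry rz.
have exy := cnum_sqlen C rx ry.
have exz := cnum_sqlen C rx rz; have eyz := cnum_sqlen C ry rz.
rewrite !cnumDl // !cnum_diag // in exz eyz.
rewrite !inE => /or4P[|||/or4P[]] /eqP[e1 e2 e3 e4]; move: exy exz eyz;
  rewrite e1 e2 e3 e4 => exy exz eyz;
  [exists (6, -6)|exists (6, 0)|exists (6, 6)|exists (12, -12)|exists (3, -6)
  |exists (18, -18)|exists (2, -6)] => //; split=> /=; lra.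
Qed.

(** Unknowns are the entries of [sixfold_lengths] for the pairs s = (u,v),
t = (u,w), r = (v,w) and b = (u, v + w - u).  The equations say that the length
of w is computed in the same way from u and from v, that u is paired additively
with the two decompositions of v + w, and that both decompositions give v + w the
same length.  The divisibilities are the integrality of the Cartan numbers of v
against u + w, of w against u + v, and of u + v against v + w - u. *)
Definition crossed_lengths_absurd (s t r b : int * int) : bool :=
  ~~ [&& r.1 * s.1 == 6 * t.1, s.2 + t.2 - 12 == b.2,
        6 * b.1 == 6 * s.1 + 6 * t.1 + r.2 * s.1 - 6 * b.2 - 36,
        (36 + 6 * t.1 + 6 * t.2 %| 6 * s.2 + r.2 * s.1)%Z,
        (36 + 6 * s.1 + 6 * s.2 %| 6 * t.2 + r.2 * s.1)%Z
      & (6 * b.1 %| 6 * b.2 + 12 * s.1 + r.2 * s.1 - 6 * s.2)%Z].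

Lemma all_crossed_lengths_absurd :
  all (fun s => all (fun t => all (fun r => all (crossed_lengths_absurd s t r)
    sixfold_lengths) sixfold_lengths) sixfold_lengths) sixfold_lengths.
Proof. by vm_compute. Qed.

(** Expand the seven squared lengths and the pairings by bilinearity in units
of the length of u: the entries found by [sqlen_ip_sum] would satisfy the
conditions listed in [crossed_lengths_absurd]. *)
Lemma no_crossed_sums u v w : root u -> root v -> root w -> root (v + w) ->
  root (u + v) -> root (u + w) -> root (v + w - u) -> False.
Proof.
move=> ru rv rw rvw ruv ruw; move Eb' : (v + w - u) => b rb.
have Eb : u + b = v + w by rewrite -Eb' addrCA subrr addr0.
have rub : root (u + b) by rewrite Eb.
have [s sT [s1 s2]] := sqlen_ip_sum ru rv ruv.
have [t tT [t1 t2]] := sqlen_ip_sum ru rw ruw.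
have [r rT [r1 r2]] := sqlen_ip_sum rv rw rvw.
have [q qT [q1 q2]] := sqlen_ip_sum ru rb rub.
have nuv := sqlenD ru rv ruv; have nuw := sqlenD ru rw ruw.
have nub := sqlenD ru rb rub.
have nvw := sqlenD rv rw rvw.
have f1 : ip u (u + b) = 2 * n u + ip u b by rewrite ipDr // ip_diag.
have f2 : ip v (v + w) = ip u v + ip v b.
  by rewrite -Eb ipDr // (cnum_sqlen C rv ru).
rewrite Eb ipDr // in f1; rewrite ipDr // ip_diag // in f2.
have k1 : ip v (u + w) = ip u v + ip v w by rewrite ipDr // (cnum_sqlen C rv ru).
have k2 : ip w (u + v) = ip u w + ip v w.
  by rewrite ipDr // (cnum_sqlen C rw ru) (cnum_sqlen C rw rv).
have k3 : ip (u + v) b = ip u b + ip v b by rewrite ipDl.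
rewrite Eb nvw in nub; rewrite nuw in k1; rewrite nuv in k2.
have p0 := sqlen_gt0 C ru.
have := all_crossed_lengths_absurd.
move=> /allP/(_ _ sT)/allP/(_ _ tT)/allP/(_ _ rT)/allP/(_ _ qT).
have cancel (k l : int) : k%:~R * n u = l%:~R * n u -> k = l.
  by move/(mulIf (lt0r_neq0 p0))/intr_inj.
have rs : (r.2 * s.1)%:~R * n u = 36 * ip v w.
  by rewrite rmorphM /= -mulrA -s1 mulrCA -r2; ring.
rewrite rmorphM /= in rs.
have -> : crossed_lengths_absurd s t r q = false; last by [].
apply/negbF; apply/andP; split; [|apply/and5P; split].
- by apply/eqP/cancel; rewrite !rmorphM /= -!mulrA -s1 -t1 mulrCA -r1; ring.
- by apply/eqP/cancel; rewrite rmorphB rmorphD /=; lra.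
- by apply/eqP/cancel; rewrite !(rmorphB, rmorphD, rmorphM) /=; lra.
- apply/dvdzP; exists (c v (u + w)); apply/esym/cancel.
  rewrite rmorphM -mulrA [X in _ * X](_ : _ = 36 * (n u + n w + ip u w)).
    by rewrite mulrCA k1 !(rmorphD, rmorphM) /=; lra.
  by rewrite !(rmorphD, rmorphM) /=; lra.
- apply/dvdzP; exists (c w (u + v)); apply/esym/cancel.
  rewrite rmorphM -mulrA [X in _ * X](_ : _ = 36 * (n u + n v + ip u v)).
    by rewrite mulrCA k2 !(rmorphD, rmorphM) /=; lra.
  by rewrite !(rmorphD, rmorphM) /=; lra.
- apply/dvdzP; exists (c (u + v) b); apply/esym/cancel.
  rewrite rmorphM -mulrA [X in _ * X](_ : _ = 36 * n b).
    by rewrite mulrCA k3 !(rmorphB, rmorphD, rmorphM) /=; lra.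
  by rewrite rmorphM /=; lra.
Qed.

(** If both alternatives fail, one of a + b', a' + b and one of a + a', b + b'
are roots.  These two sums share a summand u; the other two summands v, w satisfy
v + w = a + b, and v + w - u is the fourth root. *)
Lemma two_decompositions a b a' b' : root a -> root b -> root a' -> root b' ->
  root (a + b) -> a' + b' = a + b ->
  (~ root (a + b') /\ ~ root (a' + b)) \/ (~ root (a + a') /\ ~ root (b + b')).
Proof.
move=> ra rb ra' rb' rg e.
have cross u v w x : v + w = a + b -> u + x = v + w -> root u -> root v ->
    root w -> root x -> root (u + v) -> root (u + w) -> False.
  move=> e1 e2 ru rv rw rx ruv ruw; apply: (@no_crossed_sums u v w) => //.
    by rewrite e1.
  by rewrite -e2 addrC addKr.
have [raa|naa] := pselect (root (a + a')).
  left; split=> r'; first by apply: (cross a a' b' b).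
  by apply: (cross a' a b b') => //; rewrite addrC.
have [rbb|nbb] := pselect (root (b + b')); last by right.
left; split=> r'.
  by apply: (cross b' b a a') => //; rewrite addrC // e addrC.
have e' : b' + a' = a + b by rewrite addrC.
by apply: (cross b b' a' a) => //; [rewrite e' addrC|rewrite addrC].
Qed.
End CartanData.

(** * Weight vectors *)

Section Lie.
Variables (F : fieldType) (g : lieAlgType F).
Implicit Types x y z : g.

Lemma lieDl x x' y : lie (x + x') y = lie x y + lie x' y.
Proof. by have := lie_linearl y 1 x x'; rewrite !scale1r. Qed.
Lemma lieDr x y y' : lie x (y + y') = lie x y + lie x y'.
Proof. by have := lie_linearr x 1 y y'; rewrite !scale1r. Qed.
Lemma lie0r x : lie x 0 = 0.
Proof. by have := lieBr x 0 0; rewrite !subrr. Qed.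
Lemma lie0l x : lie 0 x = 0.
Proof. by have := lieBl x 0 0; rewrite !subrr. Qed.
Lemma lieZl a x y : lie (a *: x) y = a *: lie x y.
Proof. by have := lie_linearl y a x 0; rewrite !addr0 lie0l addr0. Qed.
Lemma lieZr a x y : lie x (a *: y) = a *: lie x y.
Proof. by have := lie_linearr x a y 0; rewrite !addr0 lie0r addr0. Qed.
Lemma lieC x y : lie x y = - lie y x.
Proof.
apply/eqP; rewrite -addr_eq0; have := lie_xx (x + y).
by rewrite lieDl !lieDr !lie_xx add0r addr0 => ->.
Qed.
Lemma lieNr x y : lie x (- y) = - lie x y.
Proof. by rewrite -scaleN1r lieZr scaleN1r. Qed.
Lemma lieNl x y : lie (- x) y = - lie x y.
Proof. by rewrite -scaleN1r lieZl scaleN1r. Qed.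

Lemma lie_der x y z : lie x (lie y z) = lie (lie x y) z + lie y (lie x z).
Proof.
have := lie_jacobi x y z; rewrite (lieC z x) lieNr (lieC z) => /eqP.
by rewrite -addrA addr_eq0 opprD !opprK addrC => /eqP ->.
Qed.
End Lie.

Section Weights.
Variables (F : fieldType) (g : lieAlgType F) (h : {vspace g}).
Implicit Types (a b : hdual h) (t : subvs_of h) (x y : g).

Lemma hdualD a b t : (a + b) t = a t + b t. Proof. by rewrite lfunE. Qed.
Lemma hdualN a t : (- a) t = - a t. Proof. by rewrite lfunE. Qed.
Lemma hdual0 t : (0 : hdual h) t = 0. Proof. by rewrite lfunE. Qed.
Lemma hdualMn a n t : (a *+ n) t = a t *+ n.
Proof. by elim: n => [|n IHn]; rewrite ?mulr0n ?hdual0 // !mulrS hdualD IHn. Qed.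

Lemma root_space_lie a b x y : root_space a x -> root_space b y ->
  root_space (a + b) (lie x y).
Proof.
move=> ax by_ t; rewrite lie_der ax by_ lieZl lieZr -scalerDl.
by rewrite hdualD.
Qed.

Lemma root_spaceZ a (k : F) x : root_space a x -> root_space a (k *: x).
Proof. by move=> ax t; rewrite lieZr ax scalerA mulrC -scalerA. Qed.
Lemma root_spaceB a x y : root_space a x -> root_space a y ->
  root_space a (x - y).
Proof. by move=> ax ay t; rewrite lieDr lieNr ax ay scalerBr. Qed.

(** Simultaneous eigenvectors for distinct eigenvalues are independent: apply
t - a(t) for the first weight a and induct. *)
Lemma weight_sum0 (s : seq (hdual h)) (y : hdual h -> g) : uniq s ->
  (forall a, a \in s -> root_space a (y a)) -> \sum_(a <- s) y a = 0 ->
  forall a, a \in s -> y a = 0.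
Proof.
elim: s y => // a s IHs y /= /andP[as_ us] wy; rewrite big_cons => sum0.
have ys b : b \in s -> y b = 0.
  move=> bs; have [t tab] : exists t, b t <> a t.
    apply/not_existsP => eab; move: as_; suff -> : a = b by rewrite bs.
    by apply/lfunP => t; apply/esym/notP/eab.
  have wyt c : c \in s -> root_space c ((c t - a t : F) *: y c).
    by move=> cs; apply/root_spaceZ/wy; rewrite inE cs orbT.
  suff sum0' : \sum_(c <- s) (c t - a t : F) *: y c = 0.
    have /eqP := IHs _ us wyt sum0' b bs.
    by rewrite scaler_eq0 subr_eq0 (introF eqP tab) => /eqP.
  have -> : \sum_(c <- s) (c t - a t : F) *: y c =
      lie (vsval t) (\sum_(c <- a :: s) y c) -
      (a t : F) *: (\sum_(c <- a :: s) y c).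
    have lsum (s' : seq (hdual h)) : lie (vsval t) (\sum_(c <- s') y c) =
        \sum_(c <- s') lie (vsval t) (y c).
      by elim/big_rec2: _ => [|c u v _ IH]; rewrite ?lie0r // lieDr IH.
    rewrite lsum scaler_sumr -sumrB big_cons wy ?mem_head // subrr add0r.
    rewrite big_seq [RHS]big_seq; apply: eq_bigr => c cs.
    by rewrite wy ?inE ?cs ?orbT // scalerBl.
  by rewrite big_cons sum0 lie0r scaler0 subr0.
move=> b; rewrite inE => /orP[/eqP->|]; last exact: ys.
by move: sum0; rewrite big_seq big1 ?addr0.
Qed.

(** Only finitely many weights can occur in a finite-dimensional space; this
bounds both the set of roots and every root string. *)
Lemma weight_count (s : seq (hdual h)) (y : hdual h -> g) : uniq s ->
  (forall a, a \in s -> root_space a (y a) /\ y a != 0) ->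
  (size s <= \dim (fullv : {vspace g}))%N.
Proof.
move=> us ys; pose Y := [tuple of map y (in_tuple s)].
suff /eqP <- : \dim <<Y>>%VS == size s by apply/dimvS/subvf.
suff : free Y by rewrite /free size_map.
apply/freeP => k sum0 i; pose k' a := oapp k 0 (insub (index a s)).
have k'E (j : 'I_(size s)) : k' s`_j = k j.
  by rewrite /k' index_uniq // insubT /= ?ltn_ord // => ?; congr k; apply/val_inj.
have wky a : a \in s -> root_space a (k' a *: y a).
  by move=> /ys[ya _]; apply: root_spaceZ.
suff /(weight_sum0 us wky)/(_ s`_i (mem_nth _ (ltn_ord i)))/eqP :
    \sum_(a <- s) k' a *: y a = 0.
  rewrite scaler_eq0 k'E; case: (ys s`_i) => [|_ /negPf->]; first exact: mem_nth.
  by rewrite orbF => /eqP.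
rewrite (big_nth 0) big_mkord -[RHS]sum0; apply: eq_bigr => j _.
by rewrite k'E (nth_map 0).
Qed.
End Weights.

(** * The sl2-triples of a Chevalley system *)

Section Chevalley.
Variables (F : fieldType) (charF : [pchar F] =i pred0).
Variables (g : lieAlgType F) (h : {vspace g}) (X : hdual h -> g).
Hypotheses (h_cartan : cartan_subalgebra h) (X_chev : chevalley_system X).
Implicit Types (a b : hdual h) (x y : g).

Lemma natF_inj : injective (fun k : nat => k%:R : F).
Proof.
have leP (m k : nat) : m%:R = k%:R :> F -> (k <= m)%N.
  move=> e; rewrite -subn_eq0 -((pcharf0P F).1 charF).
  by have [/eqP->|/ltnW km] := leqP k m; rewrite ?eqxx // natrB // e subrr.
by move=> m k e; apply/eqP; rewrite eqn_leq !leP.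
Qed.

Lemma intF_inj : injective (fun k : int => k%:~R : F).
Proof.
move=> k l /eqP; rewrite -subr_eq0 -rmorphB /= => kl.
apply/eqP; rewrite -subr_eq0; case: (k - l) kl => m.
  by rewrite -pmulrn ((pcharf0P F).1 charF).
by rewrite NegzE mulrNz !oppr_eq0 -pmulrn ((pcharf0P F).1 charF).
Qed.

(** The vector H_a of h, read off from the bracket [X_-a, X_a] = H_a. *)
Definition coroot a : subvs_of h := vsproj h (lie (X (- a)) (X a)).

Lemma X_neq0 a : is_root a -> X a != 0.
Proof. by case/X_chev.1. Qed.

Lemma X_root a : is_root a -> root_space a (X a).
Proof. by case/X_chev.1. Qed.

Lemma corootE a : is_root a -> vsval (coroot a) = lie (X (- a)) (X a).
Proof.
case/X_chev.1 => _ _ [t _]; rewrite lieC => /oppr_inj e.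
by rewrite /coroot e vsvalK.
Qed.

Lemma coroot_diag a : is_root a -> a (coroot a) = 2 :> F.
Proof.
case/X_chev.1 => _ _ [t [_ at2]]; rewrite lieC => /oppr_inj e.
by rewrite /coroot e vsvalK.
Qed.

Lemma corootN a : coroot (- a) = - coroot a.
Proof. by rewrite /coroot opprK lieC linearN. Qed.

(** The automorphism of the Chevalley system acts by -1 on h, so it carries the
root space of a to that of -a. *)
Lemma is_rootN a : is_root a -> is_root (- a).
Proof.
move=> ra; split; first by rewrite oppr_eq0; case: ra.
have [theta [kerT lieT hT XT]] := X_chev.2.
exists (X (- a)); rewrite -XT //; split.
  apply/eqP => T0; move: (X_neq0 ra); have : X a \in lker theta by rewrite memv_ker T0.
  by rewrite kerT memv0 => /eqP ->; rewrite eqxx.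
move=> t; have <- : theta (- vsval t) = vsval t.
  by rewrite hT ?opprK // memvN subvsP.
by rewrite -lieT lieNl X_root // -scaleNr linearZ /= hdualN.
Qed.

(** A vector killed by h normalizes h, and h is its own normalizer. *)
Lemma root_space0 y : root_space (0 : hdual h) y -> y \in h.
Proof.
have [_ _ self_norm] := h_cartan; move=> y0; apply: self_norm => x xh.
by rewrite lieC -(vsprojK xh) y0 hdual0 scale0r oppr0 mem0v.
Qed.

Lemma lie_XN_X a b y : is_root a -> root_space b y ->
  lie (X (- a)) (lie (X a) y) = lie (X a) (lie (X (- a)) y) + (b (coroot a) : F) *: y.
Proof. by move=> ra by_; rewrite lie_der -corootE // by_ addrC. Qed.

Lemma root_space_iter a b x y k : root_space a x -> root_space b y ->
  root_space (b + a *+ k) (iter k (lie x) y).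
Proof.
move=> ax by_; elim: k => [|k IHk] /=; first by rewrite addr0.
by rewrite mulrS addrCA; apply: root_space_lie.
Qed.

Lemma lie_X_nilpotent a b y : is_root a -> root_space b y ->
  exists k, iter k (lie (X a)) y == 0.
Proof.
move=> ra by_; apply/not_existsP => nz.
pose d := \dim (fullv : {vspace g}); pose w k := b + a *+ k.
have w_inj : injective w.
  move=> k l /addrI /(congr1 (fun f : hdual h => f (coroot a))).
  rewrite !hdualMn coroot_diag // -!mulrnA => /natF_inj /eqP.
  by rewrite eqn_mul2l => /eqP.
have : (size (map w (iota 0 d.+1)) <= d)%N.
  pose steps c := index c (map w (iota 0 d.+1)).
  apply: (@weight_count _ _ _ _ (fun c => iter (steps c) (lie (X a)) y)).
    by rewrite map_inj_uniq // iota_uniq.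
  move=> _ /mapP[k kd ->]; rewrite /steps index_map //.
  rewrite -[k in index k](@nth_iota 0%N 0 d.+1 k); last first.
    by move: kd; rewrite mem_iota.
  rewrite index_uniq ?iota_uniq ?size_iota //; last by move: kd; rewrite mem_iota.
  split; first by apply: root_space_iter => //; apply: X_root.
  by apply/negP; apply: nz.
by rewrite size_map size_iota ltnn.
Qed.

(** Write e for X_a and f for -X_-a.  Moving f across e ^ k changes the
eigenvalue of e f by a sum of weights, in arithmetic progression; the last nonzero
e ^ r y is killed by e, which determines the eigenvalue.  Its sign comes from
using X_-a instead of f. *)
Lemma sl2_eigenvalue a b y (mu : F) : is_root a -> y != 0 -> root_space b y ->
  lie (X a) (lie (X (- a)) y) = mu *: y ->
  exists2 r : nat, iter r (lie (X a)) y != 0 &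
    mu = - (r.+1%:R * (r%:R + b (coroot a))).
Proof.
move=> ra y0 by_ ey.
case/ex_minnP: (lie_X_nilpotent ra by_) => [[|r]]; first by rewrite /= (negPf y0).
move=> /eqP er0 min; have er : iter r (lie (X a)) y != 0.
  by apply/negP => /min; rewrite ltnn.
exists r => //; set m : F := b (coroot a).
have wk k : ((b + a *+ k) (coroot a) : F) = m + 2 * k%:R.
  by rewrite hdualD hdualMn coroot_diag // mulr_natr.
have wt k := root_space_iter k (X_root ra) by_.
(* The eigenvalue increases by the weight m + 2 k of e ^ k y at each step. *)
have efe k : lie (X a) (lie (X (- a)) (iter k (lie (X a)) y)) =
    (mu + k%:R * (m + k%:R - 1)) *: iter k (lie (X a)) y.
  elim: k => [|k IHk]; first by rewrite mul0r addr0.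
  rewrite [iter k.+1 _ _]/= (lie_XN_X ra (wt k)) wk lieDr IHk !lieZr -scalerDl.
  by congr (_ *: _); rewrite -[k.+1%:R]natr1; ring.
have := lie_XN_X ra (wt r); rewrite -[lie (X a) _]/(iter r.+1 (lie (X a)) y) er0.
rewrite lie0r efe wk -scalerDl => /esym /eqP; rewrite scaler_eq0 (negPf er) orbF.
rewrite -addrA addr_eq0 => /eqP ->; congr (- _).
by rewrite -[r.+1%:R]natr1; ring.
Qed.

(** Subtract from y the multiple of X_a for which the value of a at
[X_-a, y] vanishes.  The difference z satisfies [X_a, [X_-a, z]] = 0, while its
weight 2 is positive, so [sl2_eigenvalue] forces z = 0. *)
Lemma root_space_line a y : is_root a -> root_space a y -> exists k, y = k *: X a.
Proof.
move=> ra ay.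
have coh z : root_space a z -> lie (X (- a)) z \in h.
  move=> az; apply: root_space0.
  by rewrite -(addNr a); apply: root_space_lie => //; apply/X_root/is_rootN.
pose k : F := a (vsproj h (lie (X (- a)) y)) / 2; exists k.
have az : root_space a (y - k *: X a).
  by apply: root_spaceB => //; apply/root_spaceZ/X_root.
have two0 : 2 != 0 :> F by rewrite ((pcharf0P F).1 charF).
apply/eqP; rewrite -subr_eq0; apply/negPn/negP => z0.
have ez : lie (X a) (lie (X (- a)) (y - k *: X a)) = 0 *: (y - k *: X a).
  have proj : vsproj h (lie (X (- a)) (y - k *: X a)) =
      vsproj h (lie (X (- a)) y) - k *: coroot a.
    by rewrite lieDr lieNr lieZr -corootE // linearB linearZ /= vsvalK.
  have val0 : a (vsproj h (lie (X (- a)) (y - k *: X a))) = 0 :> F.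
    have -> : a (vsproj h (lie (X (- a)) (y - k *: X a))) =
        a (vsproj h (lie (X (- a)) y)) - k * a (coroot a) :> F.
      by rewrite proj linearB linearZ.
    by rewrite coroot_diag // divfK // subrr.
  by rewrite -(vsprojK (coh _ az)) lieC (X_root ra) val0 !scale0r oppr0.
have [r _ /eqP] := sl2_eigenvalue ra z0 az ez.
rewrite coroot_diag // -natrD -natrM eq_sym oppr_eq0 ((pcharf0P F).1 charF).
by rewrite muln_eq0 addn_eq0 andbF.
Qed.

(** A vector y of weight 2a is lowered into the line of X_a, which X_a kills;
its weight 4 is positive, so [sl2_eigenvalue] forces y = 0. *)
Lemma root_reduced a : is_root a -> ~ is_root (a + a).
Proof.
move=> ra [_ [y [y0 ay]]].
have /(root_space_line ra)[k ek] : root_space a (lie (X (- a)) y).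
  rewrite -[a in root_space a](addKr a); apply: root_space_lie => //.
  exact/X_root/is_rootN.
have : lie (X a) (lie (X (- a)) y) = 0 *: y.
  by rewrite ek lieZr lie_xx scaler0 scale0r.
case/(sl2_eigenvalue ra y0 ay) => r _ /eqP.
rewrite hdualD coroot_diag // -!natrD -natrM eq_sym oppr_eq0.
by rewrite ((pcharf0P F).1 charF) muln_eq0 addn_eq0 andbF.
Qed.

(** Both [X_a, [X_-a, X_b]] and [X_-a, [X_a, X_b]] are multiples of X_b.
Computing the multiples by raising and by lowering, and comparing them through
[X_a, X_-a] = -H_a, gives (r + p + 1) (r - p + b(H_a)) = 0, where p and r are the
numbers of possible steps down and up.  The last equation is the
formula f e X_b = (p + 1) r X_b for f = -X_-a. *)
Lemma root_string a b : is_root a -> is_root b -> exists p r : nat,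
  [/\ b (coroot a) = p%:R - r%:R :> F,
      iter p (lie (X (- a))) (X b) != 0, iter r (lie (X a)) (X b) != 0
    & lie (X (- a)) (lie (X a) (X b)) = - (p.+1 * r)%:R *: X b].
Proof.
move=> ra rb; have Xa := X_root ra; have XNa := X_root (is_rootN ra).
have Xb := X_root rb; set m : F := b (coroot a).
have [la ela] : exists k, lie (X (- a)) (lie (X a) (X b)) = k *: X b.
  apply: root_space_line => //; rewrite -[b in root_space b](addKr a).
  by apply: root_space_lie => //; apply: root_space_lie.
have [mu emu] : exists k, lie (X a) (lie (X (- a)) (X b)) = k *: X b.
  apply: root_space_line => //; rewrite -[b in root_space b](addNKr a).
  by apply: root_space_lie => //; apply: root_space_lie.
have [r rX emur] := sl2_eigenvalue ra (X_neq0 rb) Xb emu.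
have [p pX elap] : exists2 p : nat, iter p (lie (X (- a))) (X b) != 0 &
    la = - (p.+1%:R * (p%:R - m)).
  have [|p pX ->] := sl2_eigenvalue (mu := la) (is_rootN ra) (X_neq0 rb) Xb.
    by rewrite opprK.
  by exists p => //; rewrite corootN linearN.
have elm : la = mu + m.
  apply/eqP; rewrite -subr_eq0 -[_ == 0](orbF) -(negPf (X_neq0 rb)) -scaler_eq0.
  by rewrite scalerBl scalerDl -ela -emu (lie_XN_X ra Xb) subrr.
have em : m = p%:R - r%:R.
  have /eqP : (r + p).+1%:R * (r%:R - p%:R + m) = 0.
    have -> : (r + p).+1%:R * (r%:R - p%:R + m) = la - (mu + m).
      by rewrite elap emur -/m -!natr1 natrD; ring.
    by rewrite elm subrr.
  rewrite mulf_eq0 ((pcharf0P F).1 charF) /= addrC addr_eq0 => /eqP ->.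
  by rewrite opprB.
exists p, r; split=> //.
by rewrite ela elap em opprB addrCA subrr addr0 natrM.
Qed.

Lemma weight_root a y : y != 0 -> root_space a y -> a = 0 \/ is_root a.
Proof.
by move=> y0 ay; have [->|a0] := eqVneq a 0; [left|right; split=> //; exists y].
Qed.

Lemma iter_lie_neq0 x y p k : iter p (lie x) y != 0 -> (k <= p)%N ->
  iter k (lie x) y != 0.
Proof.
move=> p0 kp; apply: contra p0 => /eqP k0; rewrite -(subnK kp) iterD k0.
by elim: (p - k)%N => [|l /eqP IH] /=; rewrite ?IH ?lie0r.
Qed.

Definition cartan_int b a : int := xget 0 [set k : int | b (coroot a) = k%:~R].

Lemma cartan_intE a b : is_root a -> is_root b ->
  b (coroot a) = (cartan_int b a)%:~R :> F.
Proof.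
move=> ra rb; apply: (@xgetPex _ 0 [set k : int | b (coroot a) = k%:~R]).
have [p [r [-> _ _ _]]] := root_string ra rb.
by exists (p%:Z - r%:Z); rewrite /= rmorphB.
Qed.

Lemma cartan_int_unique a b (k : int) : is_root a -> is_root b ->
  b (coroot a) = k%:~R :> F -> cartan_int b a = k.
Proof. by move=> ra rb e; apply: intF_inj; rewrite -cartan_intE. Qed.

Lemma cartan_int_diag a : is_root a -> cartan_int a a = 2.
Proof. by move=> ra; apply: cartan_int_unique => //; rewrite coroot_diag. Qed.

Lemma root_string_member a b (k : int) : is_root a -> is_root b ->
    (0 <= k <= cartan_int b a) || (cartan_int b a <= k <= 0) ->
  b - k%:~R *: a = 0 \/ is_root (b - k%:~R *: a).
Proof.
move=> ra rb; have [p [r [e pX rX _]]] := root_string ra rb.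
rewrite (@cartan_int_unique a b (p%:Z - r%:Z)) ?rmorphB // => /orP[] kr.
  have [l ek] : exists l : nat, k = l%:Z by exists `|k|%N; lia.
  rewrite ek -pmulrn scaler_nat -mulNrn.
  apply: weight_root (root_space_iter l (X_root (is_rootN ra)) (X_root rb)).
  by apply: (iter_lie_neq0 pX); lia.
have [l ek] : exists l : nat, k = - l%:Z by exists `|k|%N; lia.
rewrite ek mulrNz scaleNr opprK -pmulrn scaler_nat.
apply: weight_root (root_space_iter l (X_root ra) (X_root rb)).
by apply: (iter_lie_neq0 rX); lia.
Qed.

Local Notation cint b a := (cartan_int b a).

(** * The root system *)

(** Distinct roots have independent root vectors, so a duplicate-free list of
roots of maximal length contains all of them. *)
Lemma finite_roots :
  exists2 s : seq (hdual h), uniq s & forall a, a \in s <-> is_root a.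
Proof.
pose P n := `[< exists s : seq (hdual h),
  [/\ uniq s, size s = n & forall a, a \in s -> is_root a] >].
have P0 : exists n, P n by exists 0%N; apply/asboolP; exists [::].
have bnd n : P n -> (n <= \dim (fullv : {vspace g}))%N.
  move=> /asboolP[s [us <- sr]]; apply: (weight_count (y := X)) => // a /sr ra.
  by split; [apply: X_root|apply: X_neq0].
case: (ex_maxnP P0 bnd) => n /asboolP[s [us ss sr]] max; exists s => // a.
split=> [/sr//|ra].
apply/negPn/negP => as_; have /max : P n.+1.
  apply/asboolP; exists (a :: s); split; rewrite /= ?ss ?as_ //.
  by move=> b; rewrite inE => /orP[/eqP->|/sr].
by rewrite ltnn.
Qed.

Lemma cint_subZ a b c (k : int) : is_root a -> is_root b -> is_root c ->
  is_root (b - k%:~R *: a) -> cint (b - k%:~R *: a) c = cint b c - k * cint a c.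
Proof.
move=> ra rb rc rd; apply: cartan_int_unique => //.
rewrite hdualD hdualN [(_ *: a) _]lfunE /= !cartan_intE // rmorphB rmorphM /=.
by [].
Qed.

Lemma cintD a b c : is_root a -> is_root b -> is_root (a + b) -> is_root c ->
  cint (a + b) c = cint a c + cint b c.
Proof.
by move=> *; apply: cartan_int_unique => //; rewrite hdualD !cartan_intE // rmorphD.
Qed.

Definition reflection a b : hdual h := b - (cint b a)%:~R *: a.

Lemma reflection_root a b : is_root a -> is_root b -> is_root (reflection a b).
Proof.
move=> ra rb; rewrite /reflection.
have [|d0|//] := @root_string_member a b (cint b a) ra rb.
  by rewrite !lexx !andbT le_total.
have := congr1 (fun f : hdual h => f (coroot a) : F) d0.
rewrite hdualD hdualN [(_ *: a) _]lfunE /= hdual0 (cartan_intE ra rb) coroot_diag //.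
rewrite -[_ *: _]/(_ * _) -[X in X - _]mulr1 -mulrBr => /eqP.
rewrite mulf_eq0 (_ : 1 - 2 = -1 :> F); last by ring.
rewrite oppr_eq0 oner_eq0 orbF => /eqP c0.
by rewrite c0 scale0r subr0.
Qed.

Lemma reflectionK a b : is_root a -> is_root b -> reflection a (reflection a b) = b.
Proof.
move=> ra rb; rewrite {1}/reflection cint_subZ //; last exact: reflection_root.
rewrite cartan_int_diag // /reflection.
rewrite (_ : cint b a - cint b a * 2 = - cint b a); last by ring.
by rewrite mulrNz scaleNr opprK subrK.
Qed.

Variable Phi : seq (hdual h).
Hypotheses (Phi_uniq : uniq Phi) (PhiP : forall a, a \in Phi <-> is_root a).

(** An inner product on the coroots, H_a and H_b being paired by
the sum of c(H_a) c(H_b) over all roots c. *)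
Definition coroot_form a b : int := \sum_(c <- Phi) cint c a * cint c b.

Lemma coroot_formC a b : coroot_form a b = coroot_form b a.
Proof. by apply: eq_bigr => c _; rewrite mulrC. Qed.

Lemma coroot_form_gt0 a : is_root a -> 0 < coroot_form a a.
Proof.
move=> ra; rewrite /coroot_form (bigD1_seq a) ?cartan_int_diag //=; last exact/PhiP.
by rewrite ltr_pwDl // sumr_ge0 // => c _; rewrite -expr2 sqr_ge0.
Qed.

(** Reindexing the sum by the reflection in a changes c(H_a) into its opposite
and c(H_b) into c(H_b) - c(H_a) a(H_b). *)
Lemma coroot_form_reflection a b : is_root a -> is_root b ->
  coroot_form a b *+ 2 = cint a b * coroot_form a a.
Proof.
move=> ra rb.
have perm : perm_eq (map (reflection a) Phi) Phi.
  have inj : {in Phi &, injective (reflection a)}.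
    by move=> c d /PhiP rc /PhiP rd e; rewrite -(reflectionK ra rc) e reflectionK.
  apply: uniq_perm => //; first by rewrite map_inj_in_uniq.
  move=> c; apply/mapP/idP => [[d /PhiP rd ->]|/PhiP rc].
    by apply/PhiP/reflection_root.
  by exists (reflection a c); [apply/PhiP/reflection_root|rewrite reflectionK].
suff : coroot_form a b = - coroot_form a b + cint a b * coroot_form a a.
  by rewrite mulr2n; lia.
rewrite {1}/coroot_form -(perm_big _ perm) big_map /= mulr_sumr -sumrN -big_split /=.
rewrite big_seq [RHS]big_seq; apply: eq_bigr => c /PhiP rc.
rewrite /reflection !cint_subZ ?reflection_root // ?cartan_int_diag //;
  try exact: reflection_root.
by ring.
Qed.

Lemma cint_coroot_form a b : is_root a -> is_root b ->
  cint a b * coroot_form a a = cint b a * coroot_form b b.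
Proof. by move=> ra rb; rewrite -!coroot_form_reflection // coroot_formC. Qed.

Lemma coroot_form_CauchySchwarz a b : is_root b ->
  coroot_form a b ^+ 2 <= coroot_form a a * coroot_form b b.
Proof.
move=> rb.
have : 0 <= \sum_(c <- Phi)
    (coroot_form b b * cint c a - coroot_form a b * cint c b) ^+ 2.
  by apply: sumr_ge0 => c _; apply: sqr_ge0.
rewrite [X in _ <= X](_ : _ = coroot_form b b *
    (coroot_form a a * coroot_form b b - coroot_form a b ^+ 2)).
  by rewrite pmulr_rge0 ?coroot_form_gt0 // subr_ge0.
rewrite (eq_bigr (fun c => coroot_form b b ^+ 2 * (cint c a * cint c a)
   + (- (coroot_form b b * coroot_form a b *+ 2)) * (cint c a * cint c b)
   + coroot_form a b ^+ 2 * (cint c b * cint c b))) => [|c _]; last by ring.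
rewrite !big_split /= -!mulr_sumr.
rewrite -/(coroot_form a a) -/(coroot_form a b) -/(coroot_form b b).
by ring.
Qed.

(** The hypotheses say that the product of the two Cartan numbers of a and b is
4, so that a and b would be parallel.  On the a-string through b lies
d = b - l a, which is a nonzero weight, hence a root; but d pairs to
zero with H_a and H_b, so a and b pair to zero with H_d by symmetry, contradicting
d(H_d) = 2. *)
Lemma no_parallel_coroots a b (l : int) : is_root a -> is_root b ->
  a <> b -> a <> - b ->
  cint b a = 2 * l -> l * cint a b = 2 -> False.
Proof.
move=> ra rb ab aNb e1 e2.
have [|d0|rd] := @root_string_member a b l ra rb.
- by rewrite e1; lia.
- have eb : b = l%:~R *: a by apply/eqP; rewrite -subr_eq0 d0.
  have : l \in [:: 1; -1; 2; -2].
    have l0 : l != 0 by apply/eqP => l0; rewrite l0 mul0r in e2.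
    have : (`|l| <= 2)%N.
      have e2' : (`|l| * `|cint a b|)%N = 2%N by rewrite -abszM e2.
      by apply: dvdn_leq => //; rewrite -e2' dvdn_mulr.
    by rewrite !inE; lia.
  rewrite !inE => /or4P[] /eqP el; rewrite el in eb.
  + by apply: ab; rewrite eb scale1r.
  + by apply: aNb; rewrite eb scaleN1r opprK.
  + by apply: (root_reduced ra); rewrite -[a in a + a]scale1r -scalerDl -eb.
  + apply: (root_reduced (is_rootN ra)).
    by rewrite -opprD -mulr2n -scaler_nat -scaleNr -eb.
set d := b - _ in rd.
have da : cint d a = 0 by rewrite cint_subZ // cartan_int_diag // e1; ring.
have db : cint d b = 0 by rewrite cint_subZ // cartan_int_diag // e2; ring.
have zero c : is_root c -> cint d c = 0 -> cint c d = 0.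
  move=> rc c0; have := cint_coroot_form rc rd; rewrite c0 mul0r => /eqP.
  by rewrite mulf_eq0 (gt_eqF (coroot_form_gt0 rc)) orbF => /eqP.
have := cartan_int_diag rd; rewrite {1}/d cint_subZ // (zero b rb db) (zero a ra da).
by rewrite mulr0 subr0.
Qed.

(** Cauchy-Schwarz bounds the product by 4, and [no_parallel_coroots] excludes
the value 4. *)
Lemma cint_prod_bound a b : is_root a -> is_root b -> a <> b -> a <> - b ->
  0 <= cint a b * cint b a <= 3.
Proof.
move=> ra rb ab aNb.
have e1 := coroot_form_reflection ra rb; have e2 := coroot_form_reflection rb ra.
rewrite coroot_formC in e2; have CS := coroot_form_CauchySchwarz a rb.
have Ka := coroot_form_gt0 ra; have Kb := coroot_form_gt0 rb.
have KK : 0 < coroot_form a a * coroot_form b b by rewrite mulr_gt0.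
have e : coroot_form a b ^+ 2 * 4 =
    (cint a b * cint b a) * (coroot_form a a * coroot_form b b).
  transitivity ((coroot_form a b *+ 2) * (coroot_form a b *+ 2)); first by ring.
  by rewrite {1}e1 e2; ring.
have p0 : 0 <= cint a b * cint b a.
  by rewrite -(pmulr_lge0 _ KK) -e mulr_ge0 ?sqr_ge0.
have p4 : cint a b * cint b a <= 4.
  by rewrite -(ler_pM2r KK) -e mulrC ler_pM2l.
rewrite p0 /=; suff : cint a b * cint b a <> 4 by lia.
move=> e4; have ba : b <> a by move=> ba; apply: ab.
have bNa : b <> - a by move=> bNa; apply: aNb; rewrite bNa opprK.
have nz : cint a b != 0 by apply: contra_eq_neq e4 => ->; rewrite mul0r.
have le4 : (`|cint a b| <= 4)%N.
  have e4' : (`|cint a b| * `|cint b a|)%N = 4%N by rewrite -abszM e4.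
  by apply: dvdn_leq => //; rewrite -e4' dvdn_mulr.
have hab l := no_parallel_coroots (l := l) ra rb ab aNb.
have hba l := no_parallel_coroots (l := l) rb ra ba bNa.
have : cint a b \in [:: 1; 2; 4; -1; -2; -4].
  move: e4 nz le4; move: (cint a b) (cint b a) => p q e4 nz le4.
  suff : p <> 3 /\ p <> -3 by rewrite !inE; lia.
  by split=> p3; rewrite p3 in e4; lia.
rewrite !inE => /or3P[||/or4P[]] /eqP e5; rewrite e5 in e4 hab hba.
- by apply: (hab 2); lia.
- by apply: (hab 1); lia.
- by apply: (hba 2); lia.
- by apply: (hab (-2)); lia.
- by apply: (hab (-1)); lia.
- by apply: (hba (-2)); lia.
Qed.

(** H_a corresponds to 2 a / (a,a), so the form takes the value 4 / (a,a) on it. *)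
Definition root_length a : rat := 4 / (coroot_form a a)%:~R.

Lemma cint_root_length a b : is_root a -> is_root b ->
  (cint a b)%:~R * root_length b = (cint b a)%:~R * root_length a.
Proof.
move=> ra rb; rewrite /root_length.
have Ka : (coroot_form a a)%:~R != 0 :> rat by rewrite intr_eq0 gt_eqF ?coroot_form_gt0.
have Kb : (coroot_form b b)%:~R != 0 :> rat by rewrite intr_eq0 gt_eqF ?coroot_form_gt0.
apply: (mulIf Ka); apply: (mulIf Kb).
rewrite mulrA -[RHS](_ : (cint b a * coroot_form b b)%:~R * 4 = _).
  by rewrite -cint_coroot_form // rmorphM /=; field.
by rewrite rmorphM /=; field.
Qed.

Definition root_cartan_data : cartan_data (@is_root F g h).
Proof.
refine (@CartanData _ _ (fun a b => cint a b) root_length _ _ _ _ _ _ _).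
- by move=> a; apply: is_rootN.
- by move=> a; apply: root_reduced.
- by move=> *; apply: cintD.
- by move=> a; apply: cartan_int_diag.
- by move=> a ra; rewrite divr_gt0 // ltr0z coroot_form_gt0.
- exact: cint_root_length.
- exact: cint_prod_bound.
Defined.

(** The lowest term d of the a-string through b has d(H_a) = -(p + r), which is
at least -3. *)
Lemma string_length a b (p r : nat) : is_root a -> is_root b ->
  b (coroot a) = p%:R - r%:R :> F -> iter p (lie (X (- a))) (X b) != 0 ->
  (p + r <= 3)%N.
Proof.
move=> ra rb e pX.
have cpr : cint b a = p%:Z - r%:Z by apply: cartan_int_unique; rewrite // rmorphB.
have rd : is_root (b - p%:R *: a).
  have [->|p0] := eqVneq p 0%N; first by rewrite scale0r subr0.
  have := weight_root pX (root_space_iter p (X_root (is_rootN ra)) (X_root rb)).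
  rewrite mulNrn -scaler_nat; case=> // /(congr1 (fun f : hdual h => f (coroot a) : F)).
  rewrite hdualD hdualN [(_ *: a) _]lfunE /= hdual0 e coroot_diag // => /eqP.
  rewrite -[_ *: _]/(_ * _).
  have -> : (p%:R - r%:R - p%:R * 2 == 0 :> F) = false; last by [].
  apply: contraNF p0; rewrite (_ : _ - _ = - (p + r)%:R); last by rewrite natrD; ring.
  by rewrite oppr_eq0 ((pcharf0P F).1 charF) addn_eq0 => /andP[].
have cd : cint (b - p%:R *: a) a = - (p + r)%:Z.
  have := @cint_subZ a b a p ra rb ra.
  by rewrite -pmulrn => -> //; rewrite cpr cartan_int_diag //; lia.
have [da|da] := eqVneq (b - p%:R *: a) a.
  by move: cd; rewrite da cartan_int_diag //; lia.
have [dNa|dNa] := eqVneq (b - p%:R *: a) (- a).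
  suff : cint (- a) a = - 2 by rewrite -dNa cd; lia.
  apply: cartan_int_unique => //; first exact: is_rootN.
  by rewrite hdualN cartan_intE // cartan_int_diag // mulrNz.
have := cnum_cases root_cartan_data rd ra (elimN eqP da) (elimN eqP dNa).
rewrite -[cnum root_cartan_data _ _]/(cint _ _) cd.
rewrite -[cnum root_cartan_data _ _]/(cint _ _).
by case=> [[]|[]|[]|[[]|[]]]; lia.
Qed.

(** * Structure constants *)

(** The Jacobi identity for X_-a, X_(a+b), X_-b, together with the automorphism
of the Chevalley system, gives a linear relation between H_a, H_b and H_(a+b)
with coefficients B, A and N.  Evaluate it at a and b and eliminate B. *)
Lemma structure_constant_square a b (N A : F) :
  is_root a -> is_root b -> is_root (a + b) ->
  lie (X a) (X b) = N *: X (a + b) ->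
  lie (X (- a)) (X (a + b)) = A *: X b ->
  N ^+ 2 * (cint a (a + b) * cint b a - 2 * cint b (a + b))%:~R
  = - (N * A) * (cint a b * cint b a - 4)%:~R.
Proof.
move=> ra rb rc eN eA; set c := a + b in rc eN eA *.
have rNb := is_rootN rb; have rNa := is_rootN ra; have rNc := is_rootN rc.
have [B eB] : exists B, lie (X c) (X (- b)) = B *: X a.
  apply: root_space_line => //; rewrite -[a in root_space a](addrK b).
  by apply: root_space_lie; apply: X_root.
have eN' : lie (X (- b)) (X (- a)) = - N *: X (- c).
  have [theta [_ lieT _ XT]] := X_chev.2.
  by rewrite -!XT // -lieT lieC eN linearN linearZ /= scaleNr.
have := lie_jacobi (X (- a)) (X c) (X (- b)).
rewrite eB eN' eA !lieZr [lie (X c) _]lieC scalerN scaleNr opprK => J.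
have rel : B *: coroot a + N *: coroot c + A *: coroot b = 0.
  apply: subvs_inj; rewrite linear0 -[RHS]J.
  rewrite [LHS]linearD [X in X + _ = _]linearD.
  by rewrite (linearZ_LR _ B) (linearZ_LR _ N) (linearZ_LR _ A) /= !corootE.
have {rel}J (d : hdual h) :
    B * d (coroot a) + N * d (coroot c) + A * d (coroot b) = 0 :> F.
  by rewrite -[RHS](linear0 d) -rel !linearD !linearZ.
have := J a; have := J b; rewrite !cartan_intE // !cartan_int_diag // => Jb Ja.
rewrite !(rmorphB, rmorphM) /=.
apply/eqP; rewrite -subr_eq0; apply/eqP.
have -> : forall p q r s : F,
  N ^+ 2 * (p * q - 2 * r) - - (N * A) * (s * q - 4) =
  N * (q * (B * 2 + N * p + A * s) - 2 * (B * q + N * r + A * 2)) by move=> *; ring.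
by rewrite Ja Jb !mulr0 subrr mulr0.
Qed.

(** The number N A is -(p + 1) r by [root_string], so [structure_constant_square]
determines N ^ 2 from the Cartan numbers and the string.  Since p + r <= 3, each
of the seven cases of [cnum_sum] leaves one or two strings, and N ^ 2 is 1, 4 or 9
in all of them. *)
Lemma structure_constant a b : is_root a -> is_root b -> is_root (a + b) ->
  exists2 N : int, lie (X a) (X b) = N%:~R *: X (a + b) &
    N \in [:: 1; -1; 2; -2; 3; -3].
Proof.
move=> ra rb rc.
have [N eN] : exists k, lie (X a) (X b) = k *: X (a + b).
  by apply: root_space_line => //; apply: root_space_lie; apply: X_root.
have [A eA] : exists k, lie (X (- a)) (X (a + b)) = k *: X b.
  apply: root_space_line => //; rewrite -[b in root_space b](addKr a).
  by apply: root_space_lie; apply: X_root => //; apply: is_rootN.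
have [p [r [e pX _ epr]]] := root_string ra rb.
have pr3 := string_length ra rb e pX.
have NA : N * A = - (p.+1 * r)%:R.
  apply/eqP; rewrite -subr_eq0 -[_ == 0]orbF -(negPf (X_neq0 rb)) -scaler_eq0.
  by rewrite scalerBl mulrC -epr eN lieZr eA scalerA [A * N]mulrC subrr.
(* If r = 0 then [X_a, [X_-a, X_(a+b)]] = 0, although X_(a+b) has the positive
   weight p + 2 for H_a. *)
have r0 : (0 < r)%N.
  rewrite lt0n; apply/eqP => r0; rewrite r0 in e NA.
  have [p' [r' [e' _ _ epr']]] := root_string ra rc.
  have := lie_XN_X ra (X_root rc).
  rewrite epr' eA lieZr eN scalerA -scalerDl => /eqP.
  rewrite -subr_eq0 -scalerBl scaler_eq0 (negPf (X_neq0 rc)) orbF.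
  rewrite [A * N]mulrC NA e' muln0 oppr0.
  have -> : - (p'.+1 * r')%:R - (0 + (p'%:R - r'%:R)) = - (p' * r'.+1)%:R :> F.
    by rewrite !natrM -!natr1; ring.
  rewrite oppr_eq0 ((pcharf0P F).1 charF) muln_eq0 orbF => /eqP p0.
  move: e'; rewrite hdualD coroot_diag // e subr0 p0 sub0r => /eqP.
  by rewrite -subr_eq0 opprK -!natrD ((pcharf0P F).1 charF).
have cpr : cint b a = p%:Z - r%:Z by apply: cartan_int_unique; rewrite // rmorphB.
have fin (k u v : int) : k \in [:: 1; 2; 3] -> u != 0 ->
    (p.+1 * r)%:Z * v = u * k ^+ 2 ->
    N ^+ 2 * u%:~R = (p.+1 * r)%:R * v%:~R ->
  exists2 N : int, lie (X a) (X b) = N%:~R *: X (a + b) &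
    N \in [:: 1; -1; 2; -2; 3; -3].
  move=> k3 u0 ek; rewrite pmulrn -rmorphM ek mulrC rmorphM /= => /mulfI.
  have uF : u%:~R != 0 :> F by apply/eqP => /(@intF_inj u 0); apply/eqP.
  move=> /(_ uF)/eqP; rewrite rmorphXn eqf_sqr => /orP[] /eqP eNk.
    by exists k; [rewrite eN eNk|move: k3; rewrite !inE; lia].
  by exists (- k); [rewrite eN eNk mulrNz|move: k3; rewrite !inE; lia].
have := structure_constant_square ra rb rc eN eA; rewrite NA opprK.
have := cnum_sum root_cartan_data ra rb rc.
rewrite -![cnum root_cartan_data _ _]/(cint _ _).
rewrite !inE => /or4P[|||/or4P[]] /eqP[-> e2 -> ->]; rewrite e2 in cpr *.
- have [[ep er]|[ep er]] : (p = 0 /\ r = 1 \/ p = 1 /\ r = 2)%N by lia.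
    by rewrite ep er in fin *; apply: (fin 1).
  by rewrite ep er in fin *; apply: (fin 2).
- have [ep er] : (p = 1 /\ r = 1)%N by lia.
  by rewrite ep er in fin *; apply: (fin 2).
- have [ep er] : (p = 2 /\ r = 1)%N by lia.
  by rewrite ep er in fin *; apply: (fin 3).
- have [ep er] : (p = 0 /\ r = 2)%N by lia.
  by rewrite ep er in fin *; apply: (fin 1).
- have [[ep er]|[ep er]] : (p = 0 /\ r = 1 \/ p = 1 /\ r = 2)%N by lia.
    by rewrite ep er in fin *; apply: (fin 1).
  by rewrite ep er in fin *; apply: (fin 2).
- have [ep er] : (p = 0 /\ r = 3)%N by lia.
  by rewrite ep er in fin *; apply: (fin 1).
- have [[ep er]|[ep er]] : (p = 0 /\ r = 1 \/ p = 1 /\ r = 2)%N by lia.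
    by rewrite ep er in fin *; apply: (fin 1).
  by rewrite ep er in fin *; apply: (fin 2).
Qed.
End Chevalley.

(** * Exterior squares and base change *)

Section Alternating.
Variables (R : comPzRingType) (M N : lmodType R) (f : alt_map M N).
Implicit Types x y z : M.

Lemma altDl x x' y : f (x + x') y = f x y + f x' y.
Proof. by have := alt_linearl f y 1 x x'; rewrite !scale1r. Qed.
Lemma altDr x y y' : f x (y + y') = f x y + f x y'.
Proof. by have := alt_linearr f x 1 y y'; rewrite !scale1r. Qed.
Lemma alt0l y : f 0 y = 0.
Proof. by apply: (addrI (f 0 y)); rewrite -altDl !addr0. Qed.
Lemma alt0r x : f x 0 = 0.
Proof. by apply: (addrI (f x 0)); rewrite -altDr !addr0. Qed.
Lemma altZl a x y : f (a *: x) y = a *: f x y.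
Proof. by have := alt_linearl f y a x 0; rewrite !addr0 alt0l addr0. Qed.
Lemma altZr a x y : f x (a *: y) = a *: f x y.
Proof. by have := alt_linearr f x a y 0; rewrite !addr0 alt0r addr0. Qed.
Lemma altC x y : f x y = - f y x.
Proof.
apply/eqP; rewrite -addr_eq0; have := alt_xx f (x + y).
by rewrite altDl !altDr !alt_xx add0r addr0 => ->.
Qed.
End Alternating.

(** The wedge bundled as an alternating map, which makes the bilinear calculus
above available for it. *)
Definition wedge_alt (R : comPzRingType) (M : lmodType R) : alt_map M (ext2 M) :=
  AltMap (@wedge_linearl R M) (@wedge_linearr R M) (@wedge_xx R M).

Lemma ext2_ind (R : comPzRingType) (M : lmodType R) (P : ext2 M -> Prop) :
  (forall x y, P (wedge x y)) -> (forall z w, P z -> P w -> P (z + w)) ->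
  forall z, P z.
Proof.
move=> Pw PD z; rewrite -[z]quot_reprK; move: (quot_repr z) => f.
rewrite (@free_sumE _ _ f (fset_set [set k | f k != 0])) => [|k]; last first.
  rewrite in_fset_set; last exact: free_finite.
  by rewrite notin_setE /= => /negP; rewrite negbK => /eqP.
rewrite linear_sum; apply: big_ind => [||[x y] _].
- by rewrite -(wedge_xx 0); apply: Pw.
- exact: PD.
rewrite linearZ /= -[quot_pi _ _]/(wedge_alt M x y) -altZl; exact: Pw.
Qed.

Section KernelRetract.
Variables (R : pzRingType) (E M : lmodType R) (S : set E).
Variables (p : {linear E -> M}) (f : {linear M -> E}).
(** The composite f p is a retraction of E modulo the span of S, at the
vector z. *)
Definition retract_mod z := z - f (p z) \in submod_gen_pred S.

Lemma retract_mod0 : retract_mod 0.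
Proof. by rewrite /retract_mod !linear0 addr0 rpred0. Qed.

Lemma retract_modD z w : retract_mod z -> retract_mod w -> retract_mod (z + w).
Proof. by rewrite /retract_mod => zS wS; rewrite !linearD addrACA rpredD. Qed.

Lemma retract_modZ k z : retract_mod z -> retract_mod (k *: z).
Proof.
rewrite /retract_mod => zS.
by rewrite (linearZ_LR p) (linearZ_LR f) /= -scalerBr rpredZ.
Qed.

(** If p kills S and z = f (p z) modulo the span of S for all z, then the span
of S is the kernel of p. *)
Lemma ker_retract : (forall z, S z -> p z = 0) -> (forall z, retract_mod z) ->
  [set z | p z = 0] = submod_gen S.
Proof.
move=> pS retr; apply/seteqP; split=> z /=.
  move=> pz0; have := retr z.
  by rewrite /retract_mod pz0 linear0 subr0 => /submod_genP.
case=> n [k [s [sS ->]]]; rewrite linear_sum big1 // => i _.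
by rewrite linearZ /= pS // scaler0.
Qed.
End KernelRetract.

Lemma tens0l (R : comPzRingType) (L : zmodType) (x : L) : tens (0 : R) x = 0.
Proof.
have := tens_linearl x (1 : R) 0 0.
by rewrite !scale1r addr0 -[LHS]addr0 => /addrI.
Qed.

Lemma tensZ (R : comPzRingType) (L : zmodType) (a r : R) (x : L) :
  tens (a * r) x = a *: tens r x.
Proof. by have := tens_linearl x a r 0; rewrite !addr0 tens0l addr0. Qed.

Lemma tensMz (R : comPzRingType) (L : zmodType) (r : R) (x : L) (k : int) :
  tens r (x *~ k) = k%:~R *: tens r x.
Proof.
have nat (n : nat) : tens r (x *+ n) = tens r x *+ n.
  by elim: n => [|n IHn]; rewrite ?tens_r0 // !mulrS tensDr IHn.
by rewrite scaler_int; case: k => n; rewrite ?NegzE ?mulrNz ?tensNr -?pmulrn nat.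
Qed.

(** * Positive roots and the lattice they span *)

Section Positive.
Variables (F : fieldType) (charF : [pchar F] =i pred0).
Variables (g : lieAlgType F) (h : {vspace g}) (X : hdual h -> g).
Hypotheses (h_cartan : cartan_subalgebra h) (X_chev : chevalley_system X).
Variables (B : seq (hdual h)) (B_basis : root_basis B).
Variable Phi : seq (hdual h).
Hypotheses (Phi_uniq : uniq Phi) (PhiP : forall a, a \in Phi <-> is_root a).
Implicit Types (a b c : hdual h).

Lemma nat_combD a b : nat_comb B a -> nat_comb B b -> nat_comb B (a + b).
Proof.
move=> [m ->] [n ->]; exists (fun i => m i + n i)%N.
by rewrite -big_split; apply: eq_bigr => i _; rewrite mulrnDr.
Qed.

(** The basis is free in characteristic zero, so natural coefficients adding up
to zero are zero. *)
Lemma nat_combD_eq0 a b : nat_comb B a -> nat_comb B b -> a + b = 0 -> a = 0.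
Proof.
move=> [m ->] [n ->] ab0; have [freeB _ _] := B_basis.
have /freeP indep : free (in_tuple B) by [].
have sum0 : \sum_(i < size B) ((m i + n i)%:R : F) *: (in_tuple B)`_i = 0.
  rewrite -[RHS]ab0 -big_split; apply: eq_bigr => j _.
  by rewrite scaler_nat mulrnDr.
apply: big1 => i _; have /eqP := indep _ sum0 i.
by rewrite ((pcharf0P F).1 charF) addn_eq0 => /andP[/eqP -> _].
Qed.

Lemma positive_rootD a b : positive_root B a -> positive_root B b ->
  is_root (a + b) -> positive_root B (a + b).
Proof. by move=> [_ na] [_ nb] rab; split=> //; apply: nat_combD. Qed.

(** The bracket is a weight vector for a + b, and a + b is not zero because both
roots are positive. *)
Lemma lie_X_eq0 a b : positive_root B a -> positive_root B b ->
  ~ is_root (a + b) -> lie (X a) (X b) = 0.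
Proof.
move=> [ra na] [rb nb] nab; apply/eqP/negPn/negP => ab0.
have := weight_root ab0 (root_space_lie (X_root X_chev ra) (X_root X_chev rb)).
by case=> // /(nat_combD_eq0 na nb) a0; case: ra; rewrite a0 eqxx.
Qed.

Lemma X_nZ a : positive_root B a -> X a \in nZ_pred B X.
Proof.
move=> pa; apply/asboolP; exists [:: (1, a)]; split=> [p|].
  by rewrite inE => /eqP ->.
by rewrite big_seq1 mulr1z.
Qed.

Lemma nZ_pred_ind (P : g -> Prop) : P 0 -> (forall x y, P x -> P y -> P (x + y)) ->
  (forall a (k : int), positive_root B a -> P (X a *~ k)) ->
  forall x, x \in nZ_pred B X -> P x.
Proof.
move=> P0 PD PX x /asboolP[s [sp ->]]; rewrite big_seq.
by apply: big_ind => // p /sp; apply: PX.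
Qed.

Lemma nZ_closed : nZ_lie_closed B X.
Proof.
move=> [x xn] [y yn] /=; elim/nZ_pred_ind: x / xn => [|x x' xn xn'|a k pa].
- by rewrite lie0l rpred0.
- by rewrite lieDl rpredD.
rewrite -scaler_int lieZl scaler_int rpredMz //.
elim/nZ_pred_ind: y / yn => [|y y' yn yn'|b l pb].
- by rewrite lie0r rpred0.
- by rewrite lieDr rpredD.
rewrite -scaler_int lieZr scaler_int rpredMz //.
have [rab|nab] := pselect (is_root (a + b)); last by rewrite lie_X_eq0 ?rpred0.
have [N -> _] :=
  structure_constant charF h_cartan X_chev Phi_uniq PhiP pa.1 pb.1 rab.
by rewrite scaler_int rpredMz // X_nZ //; apply: positive_rootD.
Qed.

Local Notation nZ := (nZ B X).
Local Notation val := (@nZ_val _ _ _ B X).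

(** Total in a: the value is 0 unless X_a lies in the lattice. *)
Definition nZ_gen a : nZ := insubd 0 (X a).

Lemma val_nZ_gen a : positive_root B a -> val (nZ_gen a) = X a.
Proof. by move=> pa; rewrite val_insubd X_nZ. Qed.

Definition positive_roots : seq (hdual h) :=
  [seq a <- Phi | `[< positive_root B a >]].

Lemma positive_rootsP a : reflect (positive_root B a) (a \in positive_roots).
Proof.
rewrite mem_filter; apply: (iffP andP) => [[/asboolP]//|pa].
by split; [apply/asboolP|apply/PhiP/pa.1].
Qed.

Lemma nZ_coords_exist (x : nZ) :
  exists k : hdual h -> int, val x = \sum_(c <- positive_roots) X c *~ k c.
Proof.
case: x => x /= xn; elim/nZ_pred_ind: x / xn => [|x y [k ->] [l ->]|a k pa].
- by exists (fun=> 0); rewrite big1.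
- exists (fun c => k c + l c); rewrite -big_split; apply: eq_bigr => c _.
  by rewrite mulrzDr.
exists (fun c => if c == a then k else 0).
rewrite (bigD1_seq a) ?filter_uniq //=; last exact/positive_rootsP.
by rewrite eqxx big1 ?addr0 // => c /negPf ->.
Qed.

Lemma nZ_coords_unique (k l : hdual h -> int) :
  \sum_(c <- positive_roots) X c *~ k c = \sum_(c <- positive_roots) X c *~ l c ->
  forall c, c \in positive_roots -> k c = l c.
Proof.
move=> /eqP; rewrite -subr_eq0 -sumrB => /eqP sum0 c cpos.
have root d : d \in positive_roots -> is_root d by move=> /positive_rootsP[].
have := @weight_sum0 _ _ _ positive_roots (fun c => X c *~ k c - X c *~ l c).
move=> /(_ (filter_uniq _ Phi_uniq) _ sum0 _ cpos) H; apply: (intF_inj charF).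
have /eqP : ((k c)%:~R - (l c)%:~R : F) *: X c = 0.
  rewrite scalerBl !scaler_int H // => d /root rd.
  by rewrite -!scaler_int; apply: root_spaceB; apply/root_spaceZ/X_root.
by rewrite scaler_eq0 (negPf (X_neq0 X_chev (root _ cpos))) orbF subr_eq0 => /eqP.
Qed.

(** Coordinates on the basis of root vectors, specified only at positive
roots. *)
Definition coords (x : nZ) : hdual h -> int :=
  xget (fun=> 0) [set k | val x = \sum_(c <- positive_roots) X c *~ k c].

Lemma coordsE x : val x = \sum_(c <- positive_roots) X c *~ coords x c.
Proof.
exact: (@xgetPex _ (fun=> 0) [set k | val x = \sum_(c <- positive_roots) X c *~ k c]
  (nZ_coords_exist x)).
Qed.

Lemma coordsD x y c : c \in positive_roots ->
  coords (x + y) c = coords x c + coords y c.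
Proof.
move: c; apply: nZ_coords_unique; rewrite -coordsE raddfD /= !coordsE -big_split.
by apply: eq_bigr => c _; rewrite mulrzDr.
Qed.

Lemma coords_gen a c : a \in positive_roots -> c \in positive_roots ->
  coords (nZ_gen a) c = (c == a)%:Z.
Proof.
move=> apos; move: c; apply: nZ_coords_unique.
rewrite -coordsE val_nZ_gen; last exact/positive_rootsP.
rewrite (bigD1_seq a) ?filter_uniq //= eqxx mulr1z.
by rewrite big1 ?addr0 // => c /negPf ->.
Qed.

Lemma nZ_sum_gen x : x = \sum_(c <- positive_roots) nZ_gen c *~ coords x c.
Proof.
apply: (val_inj : injective val).
rewrite coordsE raddf_sum /= big_seq [RHS]big_seq.
apply: eq_bigr => c /positive_rootsP pc.
by rewrite raddfMz /= val_nZ_gen.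
Qed.

Variable R : comPzRingType.
Local Notation nR := (tensorZ R nZ).

Definition nR_gen a : nR := tens 1 (nZ_gen a).

Lemma nR_ind (P : nR -> Prop) : P 0 -> (forall u w, P u -> P w -> P (u + w)) ->
  (forall r a, positive_root B a -> P (r *: nR_gen a)) -> forall u, P u.
Proof.
move=> P0 PD Pt; apply: tens_ind => // r x; rewrite (nZ_sum_gen x) big_seq.
apply: (big_rec (fun y => P (tens r y))) => [|c y /positive_rootsP pc IH].
  by rewrite tens_r0.
rewrite tensDr; apply: PD => //; rewrite tensMz -tensZ -[_ * r]mulr1 tensZ.
exact: Pt.
Qed.

(** Universal property of the R-module with basis the X_a, a positive. *)
Lemma nR_lift (N : lmodType R) (o : hdual h -> N) :
  exists f : {linear nR -> N}, forall a, positive_root B a -> f (nR_gen a) = o a.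
Proof.
pose f (r : R) (x : nZ) : N :=
  \sum_(c <- positive_roots) (r * (coords x c)%:~R) *: o c.
have fl x : linear (f^~ x : R^o -> N).
  move=> a r r'; rewrite /f scaler_sumr -big_split; apply: eq_bigr => c _ /=.
  by rewrite scalerA mulrA -scalerDl -mulrDl.
have fr r x x' : f r (x + x') = f r x + f r x'.
  rewrite /f -big_split big_seq [RHS]big_seq; apply: eq_bigr => c cpos.
  by rewrite coordsD // rmorphD mulrDr scalerDl.
pose L := GRing.isLinear.Build R nR N *:%R (tensor_lift f) (tensor_lift_linear fl fr).
pose L' : {linear nR -> N} := HB.pack (tensor_lift f) L.
exists L' => a pa; have apos : a \in positive_roots by apply/positive_rootsP.
rewrite -[LHS]/(tensor_lift f (tens 1 (nZ_gen a))) tensor_lift_tens // /f.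
rewrite (bigD1_seq a) ?filter_uniq //= coords_gen // eqxx mulr1 scale1r.
rewrite big_seq_cond big1 ?addr0 // => c /andP[cpos /negPf ca].
by rewrite coords_gen // ca mulr0 scale0r.
Qed.

Lemma bracket_gen cl a b (N : int) c : positive_root B a -> positive_root B b ->
  positive_root B c -> lie (X a) (X b) = N%:~R *: X c ->
  base_change R (nZ_lie cl) (nR_gen a) (nR_gen b) = N%:~R *: nR_gen c.
Proof.
move=> pa pb pc e; rewrite base_change_tens mul1r /nR_gen -tensMz; congr tens.
apply: (val_inj : injective val); rewrite raddfMz /= !val_nZ_gen // e.
by rewrite scaler_int.
Qed.

Lemma bracket_gen_eq0 cl a b : positive_root B a -> positive_root B b ->
  ~ is_root (a + b) -> base_change R (nZ_lie cl) (nR_gen a) (nR_gen b) = 0.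
Proof.
move=> pa pb nab; rewrite base_change_tens -[RHS](tens_r0 _ (1 * 1)); congr tens.
apply: (val_inj : injective val); rewrite raddf0 /= !val_nZ_gen //.
exact: lie_X_eq0.
Qed.

(** * The kernel of the bracket *)

Variable cl : nZ_lie_closed B X.
Local Notation br := (base_change R (nZ_lie cl)).
Definition commuting_wedges : set (ext2 nR) :=
  [set z | exists x y : nR, br x y = 0 /\ z = wedge x y].
Local Notation comm := (submod_gen_pred commuting_wedges).

Lemma commuting_wedge x y : br x y = 0 -> wedge x y \in comm.
Proof. by move=> xy0; apply/submod_genP/sub_submod_gen; exists x, y. Qed.

Local Notation w := (wedge_alt nR).

(** X_a + X_a' commutes with N' X_b - N X_b': the mixed brackets vanish and the
two others cancel.  Expand the wedge of these two vectors; its mixed terms are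
wedges of commuting vectors. *)
Lemma exchange_nonroots a b a' b' c (N N' : int) :
  [/\ positive_root B a, positive_root B b, positive_root B a', positive_root B b'
    & positive_root B c] ->
  ~ is_root (a + b') -> ~ is_root (a' + b) ->
  lie (X a) (X b) = N%:~R *: X c -> lie (X a') (X b') = N'%:~R *: X c ->
  N'%:~R *: w (nR_gen a) (nR_gen b) - N%:~R *: w (nR_gen a') (nR_gen b') \in comm.
Proof.
case=> pa pb pa' pb' pc n1 n2 e e'.
have z1 := bracket_gen_eq0 cl pa pb' n1; have z2 := bracket_gen_eq0 cl pa' pb n2.
have br0 : br (nR_gen a + nR_gen a') (N'%:~R *: nR_gen b - N%:~R *: nR_gen b') = 0.
  rewrite altDl !altDr -!scaleNr !altZr z1 z2 !scaler0 addr0 add0r.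
  rewrite (bracket_gen cl pa pb pc e) (bracket_gen cl pa' pb' pc e').
  by rewrite !scalerA -scalerDl mulNr [_%:~R * _]mulrC subrr scale0r.
have := commuting_wedge br0; rewrite -[wedge _ _]/(w _ _).
rewrite altDl !altDr -!scaleNr !altZr.
have W1 := commuting_wedge z1; have W2 := commuting_wedge z2.
rewrite [X in _ + X]addrC addrACA rpredDr ?scaleNr //.
by rewrite rpredD ?rpredN ?rpredZ.
Qed.

(** By [two_decompositions] the previous lemma applies to the pairs (a,b) and
(a',b'), or to (a,b) and (b',a'), where the sign of N' changes along with that of
the wedge. *)
Lemma exchange a b a' b' (N N' : int) : positive_root B a -> positive_root B b ->
  positive_root B a' -> positive_root B b' -> is_root (a + b) -> a' + b' = a + b ->
  lie (X a) (X b) = N%:~R *: X (a + b) -> lie (X a') (X b') = N'%:~R *: X (a + b) ->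
  N'%:~R *: w (nR_gen a) (nR_gen b) - N%:~R *: w (nR_gen a') (nR_gen b') \in comm.
Proof.
move=> pa pb pa' pb' rab eab e e'.
have pc : positive_root B (a + b) by apply: positive_rootD.
have C := root_cartan_data charF h_cartan X_chev Phi_uniq PhiP.
have [[n1 n2]|[n1 n2]] := two_decompositions C pa.1 pb.1 pa'.1 pb'.1 rab eab.
  exact: (exchange_nonroots (c := a + b)).
have e'' : lie (X b') (X a') = (- N')%:~R *: X (a + b).
  by rewrite lieC e' mulrNz scaleNr.
have := @exchange_nonroots a b b' a' _ N (- N') (And5 pa pb pb' pa' pc) n1 _ e e''.
rewrite [b' + b]addrC => /(_ n2).
by rewrite [w (nR_gen b') _]altC mulrNz scalerN scaleNr opprK addrC -opprB rpredN.
Qed.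

Hypotheses (inv2 : exists u : R, 2 * u = 1) (inv3 : exists u : R, 3 * u = 1).

Lemma small_int_inv (N : int) : N \in [:: 1; -1; 2; -2; 3; -3] ->
  exists u : R, u * N%:~R = 1.
Proof.
have inv (k : int) : (exists u : R, u * k%:~R = 1) -> exists u : R, u * (- k)%:~R = 1.
  by case=> u uk; exists (- u); rewrite mulrNz mulrNN.
have [u2 e2] := inv2; have [u3 e3] := inv3.
have i1 : exists u : R, u * (1 : int)%:~R = 1 by exists 1; rewrite mulr1.
have i2 : exists u : R, u * (2 : int)%:~R = 1 by exists u2; rewrite mulrC.
have i3 : exists u : R, u * (3 : int)%:~R = 1 by exists u3; rewrite mulrC.
by rewrite !inE => /or4P[|||/or3P[]] /eqP ->; rewrite //; apply: inv.
Qed.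

(** Take o to be X_a' /\ X_b' divided by its structure constant N' for one
decomposition of c, if there is one; [exchange] compares it with all the others. *)
Lemma wedge_normal_form c : exists o : ext2 nR, forall a b (N : int),
  positive_root B a -> positive_root B b -> a + b = c -> is_root c ->
  lie (X a) (X b) = N%:~R *: X c -> w (nR_gen a) (nR_gen b) - N%:~R *: o \in comm.
Proof.
have [[[a' b'] [pa' pb' eab' rc]]|none] := pselect (exists ab : hdual h * hdual h,
    [/\ positive_root B ab.1, positive_root B ab.2, ab.1 + ab.2 = c
      & is_root c]); last first.
  by exists 0 => a b N pa pb e rc; case: none; exists (a, b).
rewrite /= in pa' pb' eab'.
have rab' : is_root (a' + b') by rewrite eab'.
have [N' e' /small_int_inv[u uN']] :=
  structure_constant charF h_cartan X_chev Phi_uniq PhiP pa'.1 pb'.1 rab'.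
exists (u *: w (nR_gen a') (nR_gen b')) => a b N pa pb eab _ e.
have -> : w (nR_gen a) (nR_gen b) - N%:~R *: (u *: w (nR_gen a') (nR_gen b')) =
    u *: (N'%:~R *: w (nR_gen a) (nR_gen b) - N%:~R *: w (nR_gen a') (nR_gen b')).
  by rewrite scalerBr !scalerA uN' scale1r [u * N%:~R]mulrC.
rewrite -eab in e eab' rc; rewrite eab' in e'.
by apply/rpredZ/exchange.
Qed.

(** The congruence z = f [z] is linear in z, so it suffices to check it on
wedges of two basis vectors, where it is [wedge_normal_form] or, when the sum of
the two roots is not a root, holds because the two vectors commute. *)
Lemma bracket_kernel : [set z : ext2 nR | ext2_lift br z = 0] =
  submod_gen commuting_wedges.
Proof.
pose lift : {linear ext2 nR -> nR} := HB.pack (ext2_lift br)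
  (GRing.isLinear.Build R (ext2 nR) nR *:%R (ext2_lift br) (ext2_lift_linear br)).
have liftE x y : lift (w x y) = br x y by apply: ext2_lift_wedge.
have [om omP] := choice wedge_normal_form.
have [f fP] := nR_lift om.
apply: (ker_retract (p := lift) (f := f)).
  by move=> _ [x [y [xy0 ->]]]; rewrite -[RHS]xy0; apply: liftE.
pose P := retract_mod commuting_wedges lift f.
have P0 : P 0 by apply: retract_mod0.
have PD y z : P y -> P z -> P (y + z) by apply: retract_modD.
have PZ k y : P y -> P (k *: y) by apply: retract_modZ.
suff Pw x y : P (w x y) by exact: (@ext2_ind R nR P Pw PD).
elim/nR_ind: x => [|x x' Hx Hx'|r a pa]; first by rewrite alt0l.
  by rewrite altDl; apply: PD.
rewrite altZl; apply: (PZ r).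
elim/nR_ind: y => [|y y' Hy Hy'|s b pb]; first by rewrite alt0r.
  by rewrite altDr; apply: PD.
rewrite altZr; apply: (PZ s); rewrite /P /retract_mod liftE.
have [rab|nab] := pselect (is_root (a + b)); last first.
  rewrite bracket_gen_eq0 // linear0 subr0.
  exact/commuting_wedge/bracket_gen_eq0.
have [N e _] :=
  structure_constant charF h_cartan X_chev Phi_uniq PhiP pa.1 pb.1 rab.
have pab := positive_rootD pa pb rab.
by rewrite (bracket_gen cl pa pb pab e) linearZ /= fP //; apply: omP.
Qed.
End Positive.

Theorem proposition6p7 (F : fieldType) (charF : [pchar F] =i pred0)
  (g : lieAlgType F) (h : {vspace g})
  (g_red : reductive g) (h_split : split_cartan h)
  (X : hdual h -> g) (X_chev : chevalley_system X)
  (B : seq (hdual h)) (B_basis : root_basis B)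
  (R : comPzRingType)
  (inv2 : exists u : R, 2 * u = 1) (inv3 : exists u : R, 3 * u = 1) :
  exists nZ_closed : nZ_lie_closed B X,
    let nR := tensorZ R (nZ B X) in
    let bracket : alt_map nR nR := base_change R (nZ_lie nZ_closed) in
    [set z : ext2 nR | ext2_lift bracket z = 0] =
    submod_gen [set z : ext2 nR | exists x y : nR,
                  bracket x y = 0 /\ z = wedge x y].
Proof.
have [Phi Phi_uniq PhiP] := finite_roots X_chev.
exists (nZ_closed charF h_split.1 X_chev B_basis Phi_uniq PhiP).
exact: (bracket_kernel charF h_split.1 X_chev B_basis Phi_uniq PhiP).
Qed.
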